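(* The groups $P_\infty$ and $B_\infty$ (the pure braid group and the braid group on infinitely many strands) are both $C^*$-simple.
   Context: $B_\infty$ is the group generated by $\{s_i\}_{i=1}^\infty$ with relations $s_is_{i+1}s_i=s_{i+1}s_is_{i+1}$ for all $i\geq1$ and $s_is_j=s_js_i$ when $|i-j|\geq2$. Let $S_\infty$ be the infinite symmetric group (finitely supported permutations of $\{1,2,\dotsc\}$). $P_\infty$ is the kernel of the surjection $B_\infty\to S_\infty$ sending $s_i$ to the transposition $(i,i+1)$. A discrete group $G$ is $C^*$-simple if its reduced group $C^*$-algebra $C^*_r(G)$ is simple, i.e. has no nontrivial proper closed two-sided ideals. *)

(* Defs.v *)
From HB Require Import structures.
From mathcomp Require Import all_boot all_order all_algebra all_fingroup.
From mathcomp Require Import generic_quotient complex.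
From mathcomp Require Import all_classical all_reals.
From mathcomp Require Import ereal esum.
From mathcomp Require Import zify ring lra.

Set Implicit Arguments.
Unset Strict Implicit.
Unset Printing Implicit Defensive.

Import Order.TTheory GRing.Theory Num.Theory ComplexField.Normc.
Local Open Scope classical_set_scope.
Local Open Scope ring_scope.
Local Open Scope quotient_scope.

(* Groups given by generators and relations. The letter (a, false) stands for
   the generator a and (a, true) for its formal inverse. *)

Section Presentation.
Variable gen : choiceType.

Definition word := seq (gen * bool).

Implicit Types (u v w : word) (rels : word -> word -> Prop).

Inductive pres_cong rels : word -> word -> Prop :=
| pres_refl u : pres_cong rels u u
| pres_sym u v : pres_cong rels u v -> pres_cong rels v u
| pres_trans u v w :
    pres_cong rels u v -> pres_cong rels v w -> pres_cong rels u w
| pres_cat u u' v v' :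
    pres_cong rels u u' -> pres_cong rels v v' -> pres_cong rels (u ++ v) (u' ++ v')
| pres_cancel a b : pres_cong rels [:: (a, b); (a, ~~ b)] [::]
| pres_rel u v : rels u v -> pres_cong rels u v.

Definition word_inv w : word := rev [seq (p.1, ~~ p.2) | p <- w].

Lemma word_invK : involutive word_inv.
Proof.
move=> w; rewrite /word_inv map_rev revK -map_comp -[RHS]map_id.
by apply: eq_map => -[a b] /=; rewrite negbK.
Qed.

Lemma pres_cong_mulV rels w : pres_cong rels (word_inv w ++ w) [::].
Proof.
elim: w => [|[a b] w IHw]; first exact: pres_refl.
rewrite /word_inv /= rev_cons -cats1 -catA -/(word_inv w).
apply: pres_trans IHw; apply: pres_cat; first exact: pres_refl.
rewrite -[X in pres_cong _ _ X]cat0s.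
rewrite -[X in pres_cong _ X _]/([:: (a, ~~ b); (a, b)] ++ w).
apply: pres_cat; last exact: pres_refl.
by rewrite -{2}[b]negbK; exact: pres_cancel.
Qed.

Lemma pres_cong_Vmul rels w : pres_cong rels (w ++ word_inv w) [::].
Proof. by rewrite -{1}[w]word_invK; exact: pres_cong_mulV. Qed.

Lemma pres_cong_inv rels u v :
  pres_cong rels u v -> pres_cong rels (word_inv u) (word_inv v).
Proof.
move=> uv; apply: (@pres_trans _ _ (word_inv u ++ (v ++ word_inv v))).
  rewrite -[X in pres_cong _ X _]cats0; apply: pres_cat; first exact: pres_refl.
  by apply: pres_sym; exact: pres_cong_Vmul.
rewrite catA -[X in pres_cong _ _ X]cat0s.
apply: pres_cat; last exact: pres_refl.
apply: pres_trans (pres_cong_mulV rels u).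
by apply: pres_cat; [exact: pres_refl | exact: pres_sym].
Qed.

Section Quotient.
Variable rels : word -> word -> Prop.

Definition pres_congb : rel word := fun u v => `[< pres_cong rels u v >].

Lemma pres_congb_refl : reflexive pres_congb.
Proof. by move=> u; apply/asboolP; exact: pres_refl. Qed.

Lemma pres_congb_sym : symmetric pres_congb.
Proof. by move=> u v; apply/asboolP/asboolP; exact: pres_sym. Qed.

Lemma pres_congb_trans : transitive pres_congb.
Proof.
by move=> v u w /asboolP uv /asboolP vw; apply/asboolP; exact: pres_trans vw.
Qed.

Canonical pres_equiv :=
  EquivRel pres_congb pres_congb_refl pres_congb_sym pres_congb_trans.

Definition presented := {eq_quot pres_equiv}.
HB.instance Definition _ := Choice.on presented.
HB.instance Definition _ := EqQuotient.on presented.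

Definition pres_one : presented := \pi_presented [::].
Definition pres_mul (x y : presented) : presented := \pi_presented (repr x ++ repr y).
Definition pres_inv (x : presented) : presented := \pi_presented (word_inv (repr x)).

Lemma pres_piP u v : \pi_presented u = \pi_presented v <-> pres_cong rels u v.
Proof. by split=> [/eqmodP/asboolP|uv]; last exact/eqmodP/asboolP. Qed.

Lemma pres_repr_pi u : pres_cong rels (repr (\pi_presented u)) u.
Proof. by apply/pres_piP; rewrite reprK. Qed.

Lemma pres_mulE u v :
  pres_mul (\pi_presented u) (\pi_presented v) = \pi_presented (u ++ v).
Proof. by apply/pres_piP/pres_cat; exact: pres_repr_pi. Qed.

Lemma pres_invE u : pres_inv (\pi_presented u) = \pi_presented (word_inv u).
Proof. by apply/pres_piP/pres_cong_inv; exact: pres_repr_pi. Qed.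

Lemma pres_mulA : associative pres_mul.
Proof.
move=> x y z; elim/quotW: x => u; elim/quotW: y => v; elim/quotW: z => w.
by rewrite (pres_mulE v w) (pres_mulE u v) !(pres_mulE u) pres_mulE catA.
Qed.

Lemma pres_mul1 : left_id pres_one pres_mul.
Proof. by move=> x; elim/quotW: x => u; rewrite pres_mulE. Qed.

Lemma pres_1mul : right_id pres_one pres_mul.
Proof. by move=> x; elim/quotW: x => u; rewrite pres_mulE cats0. Qed.

Lemma pres_mulV : left_inverse pres_one pres_inv pres_mul.
Proof.
move=> x; elim/quotW: x => u; rewrite pres_invE pres_mulE.
exact/pres_piP/pres_cong_mulV.
Qed.

Lemma pres_Vmul : right_inverse pres_one pres_inv pres_mul.
Proof.
move=> x; elim/quotW: x => u; rewrite pres_invE pres_mulE.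
exact/pres_piP/pres_cong_Vmul.
Qed.

HB.instance Definition _ := isGroup.Build presented
  pres_mulA pres_mul1 pres_1mul pres_mulV pres_Vmul.

Definition pres_gen (a : gen) : presented := \pi_presented [:: (a, false)].

(* The extension of a map on generators to a homomorphism of the presented
   group; it is one (pres_lift_monoid_morphism) when the images of the
   generators satisfy the defining relations. *)
Section Lift.
Variables (H : groupType) (f : gen -> H).

Definition word_eval w : H :=
  (\prod_(p <- w) (if p.2 then (f p.1)^-1 else f p.1))%g.

Definition pres_lift (x : presented) : H := word_eval (repr x).

Hypothesis f_rel : forall u v, rels u v -> word_eval u = word_eval v.

Lemma word_eval_cong u v : pres_cong rels u v -> word_eval u = word_eval v.
Proof.
elim=> // [u1 u2 u3 _ -> _ -> //|u1 u2 v1 v2 _ e1 _ e2|a b].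
  by rewrite /word_eval !big_cat /= -!/(word_eval _) e1 e2.
rewrite /word_eval !big_cons big_nil /= mulg1.
by case: b; rewrite /= ?mulgV ?mulVg.
Qed.

Lemma pres_lift_pi u : pres_lift (\pi_presented u) = word_eval u.
Proof. exact/word_eval_cong/pres_repr_pi. Qed.

Lemma pres_lift_gen a : pres_lift (pres_gen a) = f a.
Proof. by rewrite pres_lift_pi /word_eval big_seq1. Qed.

Lemma pres_lift_monoid_morphism : monoid.monoid_morphism pres_lift.
Proof.
split; first by rewrite pres_lift_pi /word_eval big_nil.
move=> x y; elim/quotW: x => u; elim/quotW: y => v.
by rewrite [X in pres_lift X](pres_mulE u v) !pres_lift_pi /word_eval big_cat.
Qed.

End Lift.
End Quotient.
End Presentation.

(* The generators are indexed from 0: the letter i stands for s_(i+1), and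
   S_oo acts on nat = {0, 1, ...} instead of {1, 2, ...}. *)

Inductive braid_rel : word nat -> word nat -> Prop :=
| braid_rel_adjacent i : braid_rel
    [:: (i, false); (i.+1, false); (i, false)]
    [:: (i.+1, false); (i, false); (i.+1, false)]
| braid_rel_far i j : (i.+2 <= j)%N || (j.+2 <= i)%N -> braid_rel
    [:: (i, false); (j, false)] [:: (j, false); (i, false)].

Definition Binf := presented braid_rel.
HB.instance Definition _ := Group.on Binf.

Definition finitary_perm : {pred nat -> nat} := fun f =>
  `[< bijective f /\ finite_set [set n | f n <> n] >].

Record Sinf := MkSinf {
  Sinf_fun :> nat -> nat;
  Sinf_finitary : Sinf_fun \in finitary_perm }.
HB.instance Definition _ := [isSub for Sinf_fun].
HB.instance Definition _ := [Choice of Sinf by <:].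

Lemma SinfP (p : Sinf) : bijective p /\ finite_set [set n | p n <> n].
Proof. by have /asboolP := Sinf_finitary p. Qed.

Lemma Sinf_surj (p : Sinf) n : exists m, p m == n.
Proof. by have [[q _ qK] _] := SinfP p; exists (q n); rewrite qK. Qed.

Definition Sinf_finv (p : Sinf) n := xchoose (Sinf_surj p n).

Lemma Sinf_finvK (p : Sinf) : cancel (Sinf_finv p) p.
Proof. by move=> n; apply/eqP/(xchooseP (Sinf_surj p n)). Qed.

Lemma Sinf_finvKV (p : Sinf) : cancel p (Sinf_finv p).
Proof.
by move=> n; have [/bij_inj pI _] := SinfP p; apply: pI; rewrite Sinf_finvK.
Qed.

Lemma Sinf_one_subproof : id \in finitary_perm.
Proof.
apply/asboolP; split; first by exists id.
by apply: sub_finite_set (@finite_set0 nat) => n /=.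
Qed.

Lemma Sinf_mul_subproof (p q : Sinf) : p \o q \in finitary_perm.
Proof.
have [[bp fp] [bq fq]] := (SinfP p, SinfP q).
apply/asboolP; split; first exact: bij_comp.
have : finite_set ([set n | p n <> n] `|` [set n | q n <> n]).
  by rewrite finite_setU.
apply: sub_finite_set => n /=; have [qn|] := pselect (q n = n); last by right.
by rewrite qn; left.
Qed.

Lemma Sinf_inv_subproof (p : Sinf) : Sinf_finv p \in finitary_perm.
Proof.
have [_ fp] := SinfP p; apply/asboolP; split.
  by exists p; [exact: Sinf_finvK | exact: Sinf_finvKV].
apply: sub_finite_set fp => n /= pn pnn; apply: pn.
by rewrite -{1}pnn Sinf_finvKV.
Qed.

Definition Sinf_one : Sinf := MkSinf Sinf_one_subproof.
Definition Sinf_mul (p q : Sinf) : Sinf := MkSinf (Sinf_mul_subproof p q).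
Definition Sinf_inv (p : Sinf) : Sinf := MkSinf (Sinf_inv_subproof p).

Lemma Sinf_eqP (p q : Sinf) : p =1 q -> p = q.
Proof. by move=> pq; apply/val_inj/funext. Qed.

Lemma Sinf_mulA : associative Sinf_mul. Proof. by move=> p q r; exact: Sinf_eqP. Qed.
Lemma Sinf_mul1 : left_id Sinf_one Sinf_mul. Proof. by move=> p; exact: Sinf_eqP. Qed.
Lemma Sinf_1mul : right_id Sinf_one Sinf_mul. Proof. by move=> p; exact: Sinf_eqP. Qed.
Lemma Sinf_mulV : left_inverse Sinf_one Sinf_inv Sinf_mul.
Proof. by move=> p; apply: Sinf_eqP; exact: Sinf_finvKV. Qed.
Lemma Sinf_Vmul : right_inverse Sinf_one Sinf_inv Sinf_mul.
Proof. by move=> p; apply: Sinf_eqP; exact: Sinf_finvK. Qed.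

HB.instance Definition _ := isGroup.Build Sinf
  Sinf_mulA Sinf_mul1 Sinf_1mul Sinf_mulV Sinf_Vmul.

Definition adjacent_swap (i n : nat) : nat :=
  if n == i then i.+1 else if n == i.+1 then i else n.

Lemma adjacent_swapK i : involutive (adjacent_swap i).
Proof.
move=> n; rewrite /adjacent_swap; have [->|ni] := eqVneq n i.
  by rewrite eqxx; case: ifP => // /eqP.
have [->|nSi] := eqVneq n i.+1; first by rewrite eqxx.
by rewrite (negPf ni) (negPf nSi).
Qed.

Lemma adjacent_swap_finitary i : adjacent_swap i \in finitary_perm.
Proof.
apply/asboolP; split; first exact: inv_bij (@adjacent_swapK i).
have := finite_set2 i i.+1; apply: sub_finite_set => n /=.
rewrite /adjacent_swap; have [->|_] := eqVneq n i; first by left.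
by have [->|_] := eqVneq n i.+1; first by right.
Qed.

Definition Sinf_swap i : Sinf := MkSinf (adjacent_swap_finitary i).

Definition braid_perm : Binf -> Sinf := pres_lift Sinf_swap.

Lemma Sinf_swap_braid_rel u v :
  braid_rel u v -> word_eval Sinf_swap u = word_eval Sinf_swap v.
Proof.
have sw (i n : nat) : let m := adjacent_swap i n in
    (n = i /\ m = i.+1) \/ (n = i.+1 /\ m = i) \/
    (n <> i /\ n <> i.+1 /\ m = n).
  rewrite /= /adjacent_swap; case: eqP => [->|ni]; first by left.
  by case: eqP => [->|nSi]; [right; left | right; right].
case=> [i|i j ij]; rewrite /word_eval !big_cons big_nil /= !mulg1;
  apply: Sinf_eqP => n /=.
- have := sw i (adjacent_swap i.+1 (adjacent_swap i n)).
  have := sw i.+1 (adjacent_swap i (adjacent_swap i.+1 n)).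
  have := sw i.+1 (adjacent_swap i n); have := sw i (adjacent_swap i.+1 n).
  by have := sw i n; have := sw i.+1 n; rewrite /=; lia.
- have := sw i (adjacent_swap j n); have := sw j (adjacent_swap i n).
  by have := sw i n; have := sw j n; rewrite /=; lia.
Qed.

Lemma braid_perm_gen i : braid_perm (pres_gen _ i) = Sinf_swap i.
Proof. exact: pres_lift_gen Sinf_swap_braid_rel i. Qed.

HB.instance Definition _ := isUMagmaMorphism.Build Binf Sinf braid_perm
  (pres_lift_monoid_morphism Sinf_swap_braid_rel).

(* the kernel of B_oo -> S_oo *)
Definition pure_braid : {pred Binf} := fun x => braid_perm x == 1%g.

Lemma pure_braid_group_closed : group_closed pure_braid.
Proof.
split=> [|x y]; rewrite !unfold_in; first by rewrite gmulf1.
by move=> /eqP x1 /eqP y1; rewrite gmulfF /= x1 y1 divg1.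
Qed.

Record Pinf := MkPinf { Pinf_val :> Binf; _ : Pinf_val \in pure_braid }.
HB.instance Definition _ := [isSub for Pinf_val].
HB.instance Definition _ := [Choice of Pinf by <:].
HB.instance Definition _ :=
  SubChoice_isSubGroup.Build Binf pure_braid Pinf pure_braid_group_closed.

Section Ell2.
Variables (R : realType) (G : choiceType).

Definition sq_mass (f : G -> R[i]^o) : \bar R :=
  (\esum_(x in [set: G]) (normc (f x) ^+ 2)%:E)%E.

Definition sq_summable : {pred G -> R[i]^o} :=
  fun f => `[< (sq_mass f < +oo)%E >].

Lemma esum_scale_lty (c : R) (u : G -> R) : 0 <= c -> (forall x, 0 <= u x) ->
  (\esum_(x in [set: G]) (u x)%:E < +oo)%E ->
  (\esum_(x in [set: G]) (c * u x)%:E < +oo)%E.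
Proof.
move=> c0 u0 uoo; apply: (@le_lt_trans _ _
  (c%:E * \esum_(x in [set: G]) (u x)%:E)%E); last exact: lte_mul_pinfty.
apply: ge_ereal_sup => _ [X XG <-].
under eq_fsbigr do rewrite EFinM.
rewrite -ge0_mule_fsumr; last by move=> x; rewrite lee_fin.
by apply: lee_wpmul2l; rewrite ?lee_fin //; apply: ereal_sup_ubound; exists X.
Qed.

Lemma sq_summable_submod_closed : submod_closed sq_summable.
Proof.
split=> [|a f g].
  apply/asboolP; rewrite /sq_mass esum1 // => x _.
  by rewrite normc0 expr0n.
move=> /asboolP fS /asboolP gS; apply/asboolP.
pose c := normc a ^+ 2 *+ 2.
have c0 : 0 <= c by rewrite mulrn_wge0 ?sqr_ge0.
have nc0 (z : R[i]) : 0 <= normc z by case: z => u v; exact: sqrtr_ge0.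
have ub x : ((normc ((a *: f + g) x) ^+ 2)%:E <=
    (c * normc (f x) ^+ 2)%:E + (normc (g x) ^+ 2 *+ 2)%:E)%E.
  rewrite -EFinD lee_fin; set z := (a *: f + g) x.
  have : normc z <= normc a * normc (f x) + normc (g x).
    by rewrite -normcM; exact: le_normcD.
  have := nc0 z; have := nc0 a; have := nc0 (f x); have := nc0 (g x).
  rewrite /c; move: (normc z) (normc a) (normc (f x)) (normc (g x)) => p q r s.
  move=> s0 r0 q0 p0 le; have : p ^+ 2 <= (q * r + s) ^+ 2.
    by rewrite lerXn2r // nnegrE // addr_ge0 // mulr_ge0.
  move/le_trans; apply; rewrite -subr_ge0.
  by have := sqr_ge0 (q * r - s); lra.
apply: le_lt_trans (le_esum (fun x _ => ub x)) _.
rewrite esumD; last 2 first.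
- by move=> x _; rewrite lee_fin mulr_ge0 ?sqr_ge0.
- by move=> x _; rewrite lee_fin mulrn_wge0 ?sqr_ge0.
apply: lte_add_pinfty; first by apply: esum_scale_lty => // x; exact: sqr_ge0.
under eq_esum do rewrite -mulr_natl.
by apply: esum_scale_lty => // x; exact: sqr_ge0.
Qed.

Record ell2 := MkEll2 {
  ell2_fun :> G -> R[i]^o;
  ell2_summable : ell2_fun \in sq_summable }.
HB.instance Definition _ := [isSub for ell2_fun].
HB.instance Definition _ := [Choice of ell2 by <:].
HB.instance Definition _ := GRing.SubChoice_isSubLmodule.Build
  R[i] (G -> R[i]^o) sq_summable ell2 sq_summable_submod_closed.

Definition ell2_norm (f : ell2) : R := Num.sqrt (fine (sq_mass f)).

(* The supremum is taken in \bar R, so it is +oo when T is unbounded. *)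
Definition op_norm (T : ell2 -> ell2) : \bar R :=
  ereal_sup [set (ell2_norm (T f))%:E | f in [set f | ell2_norm f <= 1]].

Definition bounded_op (T : ell2 -> ell2) : Prop :=
  linear T /\ (op_norm T < +oo)%E.

(* The operator-norm closure of A in the algebra of bounded operators. *)
Definition op_closure (A : set (ell2 -> ell2)) : set (ell2 -> ell2) :=
  [set T | bounded_op T /\
     forall e : R, 0 < e -> exists2 S, A S & (op_norm (T - S)%R < e%:E)%E].

(* The norm-closed two-sided ideals I of an operator algebra A; the sums and
   multiples in ideal_linear, ideal_zero and op_closure are pointwise. *)
Record closed_ideal (A I : set (ell2 -> ell2)) : Prop := {
  ideal_sub : I `<=` A;
  ideal_zero : I 0;
  ideal_linear : forall (a : R[i]) S T, I S -> I T -> I (a *: S + T);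
  ideal_left : forall S T, A S -> I T -> I (S \o T);
  ideal_right : forall S T, A S -> I T -> I (T \o S);
  ideal_closed : op_closure I `<=` I }.

Definition simple_op_algebra (A : set (ell2 -> ell2)) : Prop :=
  forall I, closed_ideal A I -> I = [set 0] \/ I = A.

End Ell2.

Section ReducedCstar.
Variables (R : realType) (G : groupType).

Lemma left_translate_subproof (g : G) (f : ell2 R G) :
  (fun h => f (g^-1 * h)%g) \in @sq_summable R G.
Proof.
have /asboolP fS := ell2_summable f; apply/asboolP; move: fS.
rewrite /sq_mass (@reindex_esum R G G setT setT (fun h => g^-1 * h)%g) //.
split=> // [h h' _ _|h _]; first exact: mulgI.
by exists (g * h)%g => //; rewrite mulKg.
Qed.

Definition left_regular (g : G) (f : ell2 R G) : ell2 R G :=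
  MkEll2 (left_translate_subproof g f).

(* the image of the group algebra C[G] under the left regular representation *)
Definition group_algebra_ops : set (ell2 R G -> ell2 R G) :=
  [set T | exists s : seq (R[i] * G),
     T = \sum_(p <- s) p.1 *: left_regular p.2].

Definition reduced_Cstar : set (ell2 R G -> ell2 R G) :=
  op_closure group_algebra_ops.

Definition Cstar_simple : Prop := simple_op_algebra reduced_Cstar.

End ReducedCstar.

(* Main.v *)
Require Import Defs.
From HB Require Import structures.
From mathcomp Require Import all_boot all_order all_algebra all_fingroup.
From mathcomp Require Import generic_quotient complex.
From mathcomp Require Import all_classical all_reals.
From mathcomp Require Import ereal esum.
From mathcomp Require Import zify ring lra.

Set Implicit Arguments.
Unset Strict Implicit.
Unset Printing Implicit Defensive.

Import Order.TTheory GRing.Theory Num.Theory ComplexField.Normc.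

(* Let $G$ be $B_\infty$ or $P_\infty$. It suffices to average finitely many
   nontrivial elements away: if for every finite set of $x \ne 1$ in $G$ there
   are $g_1, ..., g_N$ with all $\frac1N \sum_i \lambda(g_i x g_i^{-1})$ small
   in norm, then a closed ideal containing an operator with nonzero trace contains
   the identity, and a nonzero operator of $C^*_r(G)$ acquires a nonzero trace
   after a translation.

   Averages are estimated as by Powers, by playing ping-pong in $B_\infty$. The
   pure braids $A_{i,n}$, $i < n$, in which strand $n$ turns around strand $i$
   freely generate a group $K_n$. Let $f$ be a braid on the strands
   $0, ..., m+1$. For $x = A_{m+1,m+3}$ and $a = A_{m+2,m+3}$ the commutator
   $v = [x, f]$ is a product of the $A_{i,m+3}$ with $i \le m+1$ and $a$ commutes
   with $f$, so $a^t x f x^{-1} a^{-t} = (a^t v a^{-t}) f$; if $v \ne 1$ the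
   elements $a^t v a^{-t}$ play ping-pong. Otherwise averaging over $a^t x$ does
   not change $f$, and $f$ fixes the strand $m+1$. Combing then gives $f = b w$
   with $b$ a braid on the strands $0, ..., m$ and $w$ a product of the
   $A_{i,m+1}$. Conjugation by powers of $A_{m+1,m+2}$ fixes $b$ and makes $w$
   play ping-pong unless $w = 1$, in which case $f = b$ involves one strand
   less. Performing these averages one after the other for decreasing $m$ thus
   makes all nontrivial braids on a given number of strands small at once. *)

(** * Braid words *)

Section Conjugation.
Local Open Scope group_scope.
Variable H : groupType.
Implicit Types (c g x y : H) (S T : H -> Prop).

Definition cj c x : H := c * x * c^-1.

Lemma cjM c : {morph cj c : x y / x * y}.
Proof. by move=> x y; rewrite /cj !mulgA mulgKV. Qed.

Lemma cj1 c : cj c 1 = 1.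
Proof. by rewrite /cj mulg1 mulgV. Qed.

Lemma cjV c : {morph cj c : x / x^-1}.
Proof. by move=> x; rewrite /cj !invgM invgK mulgA. Qed.

Lemma cj_comp c d x : cj (c * d) x = cj c (cj d x).
Proof. by rewrite /cj invgM !mulgA. Qed.

Lemma cj_cj c d x : cj c (cj d x) = cj (cj c d) (cj c x).
Proof. by rewrite -!cj_comp /cj mulgKV. Qed.

Lemma one_cj x : cj 1 x = x.
Proof. by rewrite /cj mul1g invg1 mulg1. Qed.

Lemma cjK c : cancel (cj c) (cj c^-1).
Proof. by move=> x; rewrite -cj_comp mulVg one_cj. Qed.

Lemma cjKV c : cancel (cj c^-1) (cj c).
Proof. by move=> x; rewrite -cj_comp mulgV one_cj. Qed.

Lemma cj_eqP c x : (cj c x = x) <-> (c * x = x * c).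
Proof. by rewrite /cj; split=> [{2}<-|->]; rewrite ?mulgKV ?mulgK. Qed.

Lemma cj_com c x : cj c x = x -> cj x c = c.
Proof. by move=> /cj_eqP e; apply/cj_eqP. Qed.

Lemma cj_comV c x : cj c x = x -> cj c^-1 x = x.
Proof. by move=> e; rewrite -{1}e cjK. Qed.

Lemma cj_comX c x n : cj c x = x -> cj (c ^+ n) x = x.
Proof.
by move=> e; elim: n => [|n IHn]; rewrite ?expg0 ?one_cj // expgS cj_comp IHn.
Qed.

Definition sgpow (e : bool) x : H := if e then x^-1 else x.

Lemma cj_sgpow c e x : cj c (sgpow e x) = sgpow e (cj c x).
Proof. by case: e; rewrite //= cjV. Qed.

Lemma sgpow_com e c x : cj c x = x -> cj (sgpow e c) x = x.
Proof. by case: e => //=; exact: cj_comV. Qed.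

(** The subgroup generated by [S], presented as words read from the left, so that induction treats
    one signed generator at a time; [true] marks an inverse, as in braid words. *)
Inductive generated S : H -> Prop :=
| generated1 : generated S 1
| generated_mul e s g : S s -> generated S g -> generated S (sgpow e s * g).

Lemma generatedM S x y : generated S x -> generated S y -> generated S (x * y).
Proof.
move=> Sx Sy; elim: Sx => [|e s g Ss _ IHg]; first by rewrite mul1g.
by rewrite -mulgA; exact: generated_mul.
Qed.

Lemma generated_sgpow S e s : S s -> generated S (sgpow e s).
Proof.
move=> Ss; rewrite -[X in generated _ X]mulg1.
by apply: generated_mul (generated1 _).
Qed.

Lemma generated_incl S s : S s -> generated S s.
Proof. exact: (@generated_sgpow S false). Qed.

Lemma generatedV S x : generated S x -> generated S x^-1.
Proof.
elim=> [|e s g Ss _ IHg]; first by rewrite invg1; exact: generated1.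
rewrite invgM; apply: generatedM => //.
have -> : (sgpow e s)^-1 = sgpow (~~ e) s by case: e; rewrite //= invgK.
exact: generated_sgpow.
Qed.

Lemma generated_sgpowG S e x : generated S x -> generated S (sgpow e x).
Proof. by case: e => //=; exact: generatedV. Qed.

Lemma generatedX S n x : generated S x -> generated S (x ^+ n).
Proof.
move=> Sx; elim: n => [|n IHn]; rewrite ?expg0 ?expgS; first exact: generated1.
exact: generatedM.
Qed.

Lemma generated_cj S T c x : (forall s, S s -> generated T (cj c s)) ->
  generated S x -> generated T (cj c x).
Proof.
move=> ST; elim=> [|e s g Ss _ IHg]; first by rewrite cj1; exact: generated1.
by rewrite cjM cj_sgpow; apply: generatedM IHg; apply/generated_sgpowG/ST.
Qed.

Lemma generated_sub S T x :
  (forall s, S s -> generated T s) -> generated S x -> generated T x.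
Proof.
move=> ST Sx; rewrite -[x]one_cj; apply: generated_cj Sx => s Ss.
by rewrite one_cj; exact: ST.
Qed.

Lemma generated_com S c x : (forall s, S s -> cj c s = s) ->
  generated S x -> cj c x = x.
Proof.
move=> Sc; elim=> [|e s g Ss _ IHg]; first exact: cj1.
by rewrite cjM cj_sgpow IHg Sc.
Qed.

End Conjugation.

(** * Generators of $B_\infty$ and the loops $A_{i,n}$ *)

Section BraidWords.
Local Open Scope group_scope.

Definition tau i : Binf := pres_gen braid_rel i.

Lemma Binf_piM (u v : word nat) :
  (\pi_(presented braid_rel)%qT u : Binf) * \pi_(presented braid_rel)%qT v =
  \pi_(presented braid_rel)%qT (u ++ v).
Proof. exact: pres_mulE. Qed.

Lemma tau_braid i : tau i * tau i.+1 * tau i = tau i.+1 * tau i * tau i.+1.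
Proof.
rewrite /tau /pres_gen !Binf_piM; apply/pres_piP/pres_rel.
exact: braid_rel_adjacent.
Qed.

Lemma tau_far i j : (i.+2 <= j)%N || (j.+2 <= i)%N -> cj (tau i) (tau j) = tau j.
Proof.
move=> ij; apply/cj_eqP; rewrite /tau /pres_gen !Binf_piM.
exact/pres_piP/pres_rel/braid_rel_far.
Qed.

(** The braid group on the strands $0, ..., m$: [m] counts generators, not strands. *)
Definition Bsub m := generated (fun g => exists2 l, (l < m)%N & g = tau l).

Lemma Binf_Bsub (f : Binf) : exists m, Bsub m f.
Proof.
elim/quotW: f => w; elim: w => [|[i e] w [m IHw]].
  by exists 0%N; exact: generated1.
exists (maxn i.+1 m).
have -> : \pi_(presented braid_rel)%qT ((i, e) :: w) =
    sgpow e (tau i) * \pi_(presented braid_rel)%qT w.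
  have -> : sgpow e (tau i) = \pi_(presented braid_rel)%qT [:: (i, e)].
    case: e => //; exact: pres_invE.
  by rewrite Binf_piM.
apply: generated_mul; first by exists i => //; rewrite leq_max leqnn.
apply: generated_sub IHw => _ [l lm ->]; apply: generated_incl; exists l => //.
by rewrite leq_max lm orbT.
Qed.

(* [strand_loop i n] is the pure braid $A_{i,n}$ in which strand [n] moves once
   around strand [i]; it is meant for [i < n]. *)
Fixpoint strand_loop i n : Binf :=
  if n is n'.+1 then
    if (n' <= i)%N then tau i ^+ 2 else cj (tau n') (strand_loop i n')
  else 1.
Local Notation A := strand_loop.

Lemma loop_base i : A i i.+1 = tau i ^+ 2.
Proof. by rewrite /= leqnn. Qed.

Lemma loopS i n : (i < n)%N -> A i n.+1 = cj (tau n) (A i n).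
Proof. by rewrite /= ltnNge => /negPf ->. Qed.

#[global] Arguments strand_loop : simpl never.

(** For [m = n] this is the group $K_n$; a smaller [m] leaves out the loops around the strands $m,
    ..., n-1$. *)
Definition loops m n := generated (fun g => exists2 i, (i < m)%N & g = A i n).

Lemma loop_com_above l i n : (i < n)%N -> (n < l)%N -> cj (tau l) (A i n) = A i n.
Proof.
elim: n => // n IHn; rewrite ltnS leq_eqVlt => /predU1P[->|i_n] nl.
  rewrite loop_base; apply: cj_com; apply: cj_comX; apply: tau_far; lia.
rewrite loopS // -cj_comp.
have /cj_eqP -> : cj (tau l) (tau n) = tau n by apply: tau_far; lia.
by rewrite cj_comp IHn // ltnW.
Qed.

Lemma loop_com_below l i n : (l.+1 < i)%N -> (i < n)%N -> cj (tau l) (A i n) = A i n.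
Proof.
move=> li; elim: n => // n IHn; rewrite ltnS leq_eqVlt => /predU1P[<-|i_n].
  rewrite loop_base; apply: cj_com; apply: cj_comX; apply: tau_far; lia.
rewrite loopS // -cj_comp.
have /cj_eqP -> : cj (tau l) (tau n) = tau n by apply: tau_far; lia.
by rewrite cj_comp IHn.
Qed.

Lemma loop_far_step l n x y : (l.+1 < n)%N -> cj (tau l) x = y ->
  cj (tau l) (cj (tau n) x) = cj (tau n) y.
Proof.
move=> ln <-; rewrite -!cj_comp; congr cj; apply/cj_eqP; apply: tau_far; lia.
Qed.

(** [A i l.+2] is the conjugate of [A i l] by [tau l.+1 * tau l]. The braid relation turns an extra
    [tau l] on the left into [tau l.+1] on the right, which commutes with [A i l]; larger [n] follow
    by far commutation. *)
Lemma loop_com_between l i n : (i < l)%N -> (l.+1 < n)%N -> cj (tau l) (A i n) = A i n.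
Proof.
move=> il; elim: n => // n IHn; rewrite ltnS leq_eqVlt => /predU1P[<-|ln]; last first.
  by rewrite loopS; [exact/loop_far_step/IHn | lia].
have -> : A i l.+2 = cj (tau l.+1 * tau l) (A i l).
  by rewrite loopS ?(ltnW il) ?leqW // loopS // cj_comp.
rewrite -cj_comp mulgA tau_braid cj_comp; congr cj.
exact: loop_com_above.
Qed.

Lemma cj_tau_adjacent i : cj (tau i * tau i.+1) (tau i) = tau i.+1.
Proof. by rewrite /cj tau_braid -[_ * _ * tau i.+1]mulgA mulgK. Qed.

Lemma cjX (H : groupType) (c x : H) n : cj c (x ^+ n) = cj c x ^+ n.
Proof. by elim: n => [|n IHn]; rewrite ?expg0 ?cj1 // !expgS cjM IHn. Qed.

Lemma cj_loop_up i n : (i.+1 < n)%N -> cj (tau i) (A i n) = A i.+1 n.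
Proof.
elim: n => // n IHn; rewrite ltnS leq_eqVlt => /predU1P[<-|ln]; last first.
  by rewrite !loopS //; [exact/loop_far_step/IHn | lia].
by rewrite loopS // !loop_base -cj_comp cjX cj_tau_adjacent.
Qed.

(** The product is a loop around both strands [i] and [i.+1], so crossing these two does not affect
    it. Together with [cj_loop_up] this determines the conjugate of [A i.+1 n]. *)
Lemma cj_loop_prod i n : (i.+1 < n)%N ->
  cj (tau i) (A i n * A i.+1 n) = A i n * A i.+1 n.
Proof.
elim: n => // n IHn; rewrite ltnS leq_eqVlt => /predU1P[<-|ln]; last first.
  by rewrite !loopS // -?cjM; [exact/loop_far_step/IHn | lia].
rewrite loopS // !loop_base; apply/cj_eqP.
rewrite /cj !expgS expg0 !mulg1 !mulgA mulgKV.
by rewrite mulgKV tau_braid -!mulgA; congr (_ * (_ * _)); rewrite !mulgA tau_braid.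
Qed.

Lemma cj_loop_down i n : (i.+1 < n)%N ->
  cj (tau i) (A i.+1 n) = cj (A i.+1 n)^-1 (A i n).
Proof.
move=> i_n; apply: (mulgI (A i.+1 n)).
by rewrite -{1}cj_loop_up // -cjM cj_loop_prod // /cj invgK mulgA mulKVg.
Qed.
End BraidWords.
Local Notation A := strand_loop.

(** * Colourings of strands *)

Record bij (T : Type) := MkBij {
  bij_fun :> T -> T; bij_inv : T -> T;
  bij_funK : cancel bij_fun bij_inv; bij_invK : cancel bij_inv bij_fun }.
HB.instance Definition _ T := gen_eqMixin (bij T).
HB.instance Definition _ T := gen_choiceMixin (bij T).

Section BijGroup.
Variable T : Type.
Implicit Types f g h : bij T.

Lemma bij_eq f g : f =1 g -> f = g.
Proof.
case: f g => [f f' fK f'K] [g g' gK g'K] /= /funext fg.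
subst g; have e : f' = g' by apply/funext => x; rewrite -{1}[x]g'K fK.
by subst g'; congr MkBij; exact: Prop_irrelevance.
Qed.

Definition bij_one : bij T := @MkBij T id id (fun=> erefl) (fun=> erefl).
Definition bij_mul f g : bij T :=
  MkBij (can_comp (bij_funK f) (bij_funK g)) (can_comp (bij_invK g) (bij_invK f)).
Definition bij_opp f : bij T := MkBij (bij_invK f) (bij_funK f).

Lemma bij_mulA : associative bij_mul. Proof. by move=> f g h; exact: bij_eq. Qed.
Lemma bij_mul1 : left_id bij_one bij_mul. Proof. by move=> f; exact: bij_eq. Qed.
Lemma bij_1mul : right_id bij_one bij_mul. Proof. by move=> f; exact: bij_eq. Qed.
Lemma bij_mulV : left_inverse bij_one bij_opp bij_mul.
Proof. by move=> f; apply: bij_eq; exact: bij_funK. Qed.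
Lemma bij_Vmul : right_inverse bij_one bij_opp bij_mul.
Proof. by move=> f; apply: bij_eq; exact: bij_invK. Qed.

HB.instance Definition _ :=
  isGroup.Build (bij T) bij_mulA bij_mul1 bij_1mul bij_mulV bij_Vmul.

Lemma bijM f g x : (f * g)%g x = f (g x). Proof. by []. Qed.
Lemma bijVK f x : (f^-1)%g (f x) = x. Proof. exact: bij_funK. Qed.
Lemma bijKV f x : f ((f^-1)%g x) = x. Proof. exact: bij_invK. Qed.
End BijGroup.

(* Strands are coloured by permutations of [Y] and by points of [Y]. A strand
   passing over another one acts on its colour: permutations act by conjugation
   on permutations and by evaluation on points, points act trivially. Since
   points act trivially, moving a strand coloured [inr y] around one coloured
   [inl p] changes nothing but [y], into [p y]. *)
Section Colouring.
Local Open Scope group_scope.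
Variable Y : Type.

Definition colour := (bij Y + Y)%type.
Implicit Types (q r : colour) (t : nat -> colour) (p f g : bij Y).

Definition colour_act f q : colour :=
  match q with inl g => inl (cj f g) | inr y => inr (f y) end.
Definition colour_bij q : bij Y := if q is inl g then g else 1.

Lemma colour_actM f g q : colour_act (f * g) q = colour_act f (colour_act g q).
Proof. by case: q => [h|y] //=; rewrite cj_comp. Qed.

Lemma colour_act1 q : colour_act 1 q = q.
Proof. by case: q => [h|y] //=; rewrite one_cj. Qed.

Lemma colour_bij_act f q : colour_bij (colour_act f q) = cj f (colour_bij q).
Proof. by case: q => [h|y] //=; rewrite cj1. Qed.

Definition cross_fun i t : nat -> colour := fun l =>
  if l == i then colour_act (colour_bij (t i)) (t i.+1)
  else if l == i.+1 then t i else t l.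

Definition uncross_fun i t : nat -> colour := fun l =>
  if l == i then t i.+1
  else if l == i.+1 then colour_act (colour_bij (t i.+1))^-1 (t i) else t l.

Let neqS i : (i == i.+1) = false. Proof. by rewrite ltn_eqF. Qed.
Let neSq i : (i.+1 == i) = false. Proof. by rewrite gtn_eqF. Qed.

Lemma cross_funK i : cancel (cross_fun i) (uncross_fun i).
Proof.
move=> t; apply/funext => l; rewrite /uncross_fun /cross_fun !eqxx neSq.
have [->|li] := eqVneq l i; first by [].
have [->|lSi] := eqVneq l i.+1; last by [].
by rewrite -colour_actM mulVg colour_act1.
Qed.

Lemma uncross_funK i : cancel (uncross_fun i) (cross_fun i).
Proof.
move=> t; apply/funext => l; rewrite /uncross_fun /cross_fun !eqxx neSq.
have [->|li] := eqVneq l i; first by rewrite -colour_actM mulgV colour_act1.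
by have [->|lSi] := eqVneq l i.+1.
Qed.

Definition cross i : bij (nat -> colour) := MkBij (@cross_funK i) (@uncross_funK i).

(** The adjacent relation comes down to the self-distributive law $f \cdot (g \cdot q) = (fgf^{-1})
    \cdot (f \cdot q)$, by way of [colour_bij_act]. *)
Lemma cross_braid_rel u v : braid_rel u v -> word_eval cross u = word_eval cross v.
Proof.
have nSS i : (i == i.+2) = false by rewrite ltn_eqF.
have nSSr i : (i.+2 == i) = false by rewrite gtn_eqF.
have ne := (eqxx, neqS, neSq, nSS, nSSr).
case=> [i|i j ij]; rewrite /word_eval !big_cons big_nil /= !mulg1;
  apply: bij_eq => t; apply/funext => l; rewrite !bijM /= /cross_fun.
  rewrite !ne; case: (eqVneq l i) => [e|li].
    by rewrite e !ne -!colour_actM colour_bij_act /cj mulgKV.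
  case: (eqVneq l i.+1) => [e|lSi]; first by rewrite ?e ?ne.
  by case: (eqVneq l i.+2) => [e|lSSi]; rewrite ?e ?ne.
have [-> -> -> -> [-> -> -> ->]] : [/\ (i == j) = false, (j == i) = false,
  (i.+1 == j) = false, (i == j.+1) = false & [/\ (j == i.+1) = false,
  (j.+1 == i) = false, (i.+1 == j.+1) = false & (j.+1 == i.+1) = false]].
  by split; [..|split]; apply/negP => /eqP; lia.
case: (eqVneq l i) => [e|li]; first by rewrite !ifF //; apply/negP => /eqP; lia.
case: (eqVneq l i.+1) => [e|lSi]; last by [].
by rewrite !ifF //; apply/negP => /eqP; lia.
Qed.

Definition colouring : Binf -> bij (nat -> colour) := pres_lift cross.

Lemma colouringM : {morph colouring : x y / x * y}.
Proof. exact: (pres_lift_monoid_morphism cross_braid_rel).2. Qed.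

Lemma colouring1 : colouring 1 = 1.
Proof. exact: (pres_lift_monoid_morphism cross_braid_rel).1. Qed.

Lemma colouringV : {morph colouring : x / x^-1}.
Proof.
move=> x; apply: (mulIg (colouring x)).
by rewrite -colouringM !mulVg colouring1.
Qed.

Lemma colouring_tau i : colouring (tau i) = cross i.
Proof. exact: pres_lift_gen cross_braid_rel i. Qed.

Definition set_colour t n q : nat -> colour := fun l => if l == n then q else t l.

Lemma colouring_loop i n t p y : (i < n)%N -> t i = inl p -> t n = inr y ->
  colouring (A i n) t = set_colour t n (inr (p y)).
Proof.
elim: n t => // n IHn t; rewrite ltnS leq_eqVlt => /predU1P[<-|i_n] ti tn.
  rewrite loop_base colouringM !bijM colouring_tau; apply/funext => l /=.
  rewrite /cross_fun /set_colour !eqxx neSq ti tn /= one_cj.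
  by have [->|li] := eqVneq l i; [rewrite neqS | case: eqP].
rewrite loopS // /cj !colouringM colouringV !bijM colouring_tau.
rewrite [bij_fun (cross n)^-1 t](_ : _ = uncross_fun n t) //.
rewrite IHn //; last 2 first.
- by rewrite /uncross_fun !ltn_eqF // leqW.
- by rewrite /uncross_fun eqxx.
apply/funext => l; rewrite /= /cross_fun /set_colour /uncross_fun !eqxx neSq tn.
rewrite invg1 !colour_act1.
by have [->|ln] := eqVneq l n; [rewrite neqS | case: eqP].
Qed.

End Colouring.

(** * Ping-pong *)

Section EquivariantMap.
Local Open Scope group_scope.
Variables (Y : Type) (xs : nat -> bij Y) (y0 : Y) (n : nat).
Local Notation K := (loops n.+1 n.+1).

(** Strand [n.+1] carries the point on which [A i n.+1] acts through [xs i]; the colour [y0] of the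
    later strands is a filler. *)
Definition fan y : nat -> colour Y :=
  set_colour (fun l => if (l <= n)%N then inl (xs l) else inr y0) n.+1 (inr y).

Lemma colouring_fan i e y : (i <= n)%N ->
  colouring Y (sgpow e (A i n.+1)) (fan y) = fan (sgpow e (xs i) y).
Proof.
move=> le_in.
have pos z : colouring Y (A i n.+1) (fan z) = fan (xs i z).
  rewrite (@colouring_loop _ i n.+1 _ (xs i) z) //.
  - by apply/funext => l; rewrite /fan /set_colour; case: eqP.
  - by rewrite /fan /set_colour ltn_eqF // le_in.
  - by rewrite /fan /set_colour eqxx.
case: e; last exact: pos.
by rewrite /= colouringV -{1}[y](bijKV (xs i)) -pos bijVK.
Qed.

Lemma colouring_loops_fan k y : K k -> exists z, colouring Y k (fan y) = fan z.
Proof.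
elim=> [|e s g [i lti ->] _ [z gz]]; first by exists y; rewrite colouring1.
exists (sgpow e (xs i) z); rewrite colouringM bijM gz.
exact: colouring_fan.
Qed.

(** The representative is chosen from a set that depends only on the coset $Kg$. The default [1] is
    never reached, since [g] lies in its own coset. *)
Definition coset_rep (g : Binf) : Binf := xget 1 [set t | K (g * t^-1)]%classic.

Lemma coset_repP g : K (g * (coset_rep g)^-1).
Proof.
rewrite /coset_rep; case: xgetP => [t _ //|/(_ g)].
by rewrite /= mulgV => /(_ (generated1 _)).
Qed.

Lemma coset_repM k g : K k -> coset_rep (k * g) = coset_rep g.
Proof.
move=> Kk; rewrite /coset_rep.
have -> : [set t | K (k * g * t^-1)]%classic = [set t | K (g * t^-1)]%classic.
  apply/seteqP; split=> t /= Kt; last by rewrite -mulgA; exact: generatedM.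
  by rewrite -[g](mulKg k) -mulgA; apply: generatedM => //; exact: generatedV.
by [].
Qed.

(* The subgroup generated by the loops of strand [n.+1] acts freely on [Binf] by
   left multiplication, so its action on [Y] through [xs] extends to a map
   defined on [Binf] once coset representatives are chosen. *)
Lemma equivariant_map : exists pi : Binf -> Y, forall i e g, (i <= n)%N ->
  pi (sgpow e (A i n.+1) * g) = sgpow e (xs i) (pi g).
Proof.
pose proj (t : nat -> colour Y) := if t n.+1 is inr y then y else y0.
have projE y : proj (fan y) = y by rewrite /proj /fan /set_colour eqxx.
exists (fun g => proj (colouring Y (g * (coset_rep g)^-1) (fan y0))) => i e g le_in.
rewrite coset_repM; last by apply: generated_sgpow; exists i.
have [z gz] := colouring_loops_fan y0 (coset_repP g).
by rewrite gz projE -mulgA colouringM bijM gz colouring_fan // projE.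
Qed.
End EquivariantMap.

(** * Reduced words and the action of letters on them *)

Section ReducedWords.
Definition letter_inv (p : nat * bool) := (p.1, ~~ p.2).
Definition reduced := sorted (fun p q => q != letter_inv p).

Lemma letter_invK : involutive letter_inv.
Proof. by case=> i e; rewrite /letter_inv /= negbK. Qed.

(* left multiplication of a reduced word by a letter in the free group *)
Definition push p (w : word nat) :=
  if w is q :: w' then if q == letter_inv p then w' else p :: w else [:: p].

Lemma push_reduced p w : reduced w -> reduced (push p w).
Proof.
case: w => [//|q w] /=; case: ifP => [_ /path_sorted //|/negbT qp].
by rewrite /reduced /= qp.
Qed.

Lemma pushK p w : reduced w -> push (letter_inv p) (push p w) = w.
Proof.
case: w => [|q w] /=; first by rewrite letter_invK eqxx.
have [->|qp] := eqVneq q (letter_inv p); last by rewrite /= letter_invK eqxx.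
by case: w => [//|r w] /= /andP[/negPf ->].
Qed.

(** Reduced words stand for the elements of a free group; they form the set [Y] on which the loops
    will act. *)
Definition rword := {w : word nat | reduced w}.
Definition rpush p (w : rword) : rword :=
  exist _ (push p (val w)) (push_reduced p (valP w)).

Lemma rpushK p : cancel (rpush p) (rpush (letter_inv p)).
Proof. by move=> w; apply/val_inj/pushK/valP. Qed.

Lemma rpushKV p : cancel (rpush (letter_inv p)) (rpush p).
Proof. by move=> w; rewrite -{1}[p]letter_invK rpushK. Qed.

Definition letter_bij i : bij rword :=
  MkBij (@rpushK (i, false)) (@rpushKV (i, false)).

Lemma letter_bijE p w : (sgpow p.2 (letter_bij p.1) : bij rword) w = rpush p w.
Proof. by case: p => i []. Qed.

Definition starts_with p (w : rword) := ohead (val w) == Some p.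

Lemma starts_with_inj p q w : starts_with p w -> starts_with q w -> p = q.
Proof. by rewrite /starts_with => /eqP -> /eqP[]. Qed.

Lemma rpush_starts p w : ~~ starts_with (letter_inv p) w -> starts_with p (rpush p w).
Proof.
rewrite /starts_with /rpush /=; case: (val w) => [|q v] /=; first by rewrite eqxx.
rewrite -[Some q == _]/(q == _) => /negPf ->.
exact: eqxx.
Qed.
End ReducedWords.

Section PingPong.
Local Open Scope group_scope.

(* the configuration to which the norm estimate of Powers applies *)
Definition powers_family (H : groupType) (h : nat -> H) :=
  exists D E : nat -> set H,
    [/\ forall s t, (s < t)%N -> D s `&` D t = set0,
        forall s t, (s < t)%N -> E s `&` E t = set0
      & forall t g, ~ E t g -> D t (h t * g)]%classic.

(** The left factor is absorbed into the sets [D], the right factor into the sets [E]. *)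
Lemma powers_family_transl (H : groupType) (c d : H) h :
  powers_family h -> powers_family (fun t => c * h t * d).
Proof.
case=> D [E [D0 E0 hDE]].
exists (fun t => [set g | D t (c^-1 * g)])%classic.
exists (fun t => [set g | E t (d * g)])%classic; split=> [s t st|s t st|t g /= ng].
- by apply/seteqP; split=> // g /= Dg; have := D0 s t st; move/seteqP => [/(_ _ Dg)].
- by apply/seteqP; split=> // g /= Eg; have := E0 s t st; move/seteqP => [/(_ _ Eg)].
- by rewrite -!mulgA mulKg; exact: hDE.
Qed.

Variable n : nat.
Local Notation K := (loops n n.+1).

Lemma loops_reduced v : K v ->
  exists2 w : word nat, reduced w /\ all (fun p => p.1 < n)%N w &
    v = \prod_(p <- w) sgpow p.2 (A p.1 n.+1).
Proof.
elim=> [|e s g [i lti ->] _ [w [rw wn] ->]]; first by exists [::]; rewrite ?big_nil.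
exists (push (i, e) w).
  split; first exact: push_reduced.
  case: w wn {rw} => [|q w] /=; first by rewrite lti.
  by move=> /andP[qn wn]; case: ifP => //= _; rewrite lti qn.
case: w {rw wn} => [|q w] /=; first by rewrite big_nil big_seq1 mulg1.
case: eqVneq => [->|_]; rewrite !big_cons //= mulgA.
by case: e; rewrite /= ?mulgV ?mulVg mul1g.
Qed.

(** With $a = \tau_n^2 = A_{n,n+1}$, the word [v] in the other letters maps the complement of [low]
    into [low], while positive powers of [a] map [low] off itself. Hence the translates $a^t$ [low]
    are disjoint and serve both as [D t] and as [E t]. *)
Lemma ping_pong v : K v -> v <> 1 ->
  powers_family (fun t => cj (tau n ^+ (2 * t)) v).
Proof.
move=> /loops_reduced[w [rw wn] vE] v1.
pose y0 : rword := exist _ [::] isT.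
have [pi piE] := equivariant_map letter_bij y0 n.
have piM p g : (p.1 <= n)%N -> pi (sgpow p.2 (A p.1 n.+1) * g) = rpush p (pi g).
  by move=> pn; rewrite piE // letter_bijE.
pose low g := exists2 p, (p.1 < n)%N & starts_with p (pi g).
have v_low g : ~ low g -> low (v * g).
  move=> ng; have [p [w' wE]] : exists p w', w = p :: w'.
    by case: (w) vE => [|p w' _]; [rewrite big_nil | exists p, w'].
  have : starts_with p (pi (v * g)) /\ (p.1 < n)%N; last by case; exists p.
  rewrite {}vE; move: wE rw wn => -> {v v1 w} rw wn.
  (* No two neighbouring letters of [w] cancel, so its first letter survives as the first letter of
     the image. *)
  elim: w' p rw wn => [|q w IHw] p.
    rewrite /= andbT big_seq1 => _ pn; split=> //; rewrite piM; last exact: ltnW.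
    by apply: rpush_starts; apply/negP => gp; apply: ng; exists (letter_inv p).
  move=> /= /andP[qp rw] /andP[pn wn]; split=> //.
  have [qs _] := IHw q rw wn.
  rewrite big_cons -mulgA piM; last exact: ltnW.
  by apply: rpush_starts; apply/negP => /(starts_with_inj qs) e; rewrite e eqxx in qp.
(* A word starting with a letter below [n] cannot absorb the letter [n], so all powers of it pile up
   in front. *)
have a_high g r : low g -> ~ low (tau n ^+ (2 * r.+1) * g).
  move=> [p pn gp].
  suff s : starts_with (n, false) (pi (tau n ^+ (2 * r.+1) * g)).
    by case=> q qn /(starts_with_inj s) e; rewrite -e ltnn in qn.
  elim: r => [|r IHr].
    rewrite muln1 -loop_base (piM (n, false)) //; apply: rpush_starts.
    by apply/negP => /(starts_with_inj gp) e; rewrite e ltnn in pn.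
  rewrite mulnS expgnDr -mulgA -loop_base (piM (n, false)) //; apply: rpush_starts.
  by apply/negP => /(starts_with_inj IHr).
pose D t : set Binf := [set g | low ((tau n ^+ (2 * t))^-1 * g)]%classic.
have D0 s t : (s < t)%N -> (D s `&` D t)%classic = set0.
  move=> st; apply/seteqP; split=> // g [/= gs gt].
  apply: (a_high _ (t - s).-1 gt).
  rewrite prednK ?subn_gt0 //.
  have -> : (2 * t = 2 * s + 2 * (t - s))%N by rewrite -mulnDr subnKC // ltnW.
  by rewrite (expgnDr _ (2 * s)) invgM -!mulgA mulKVg.
exists D, D; split=> // t g nD; rewrite /D /cj /= -!mulgA mulKg.
exact: v_low.
Qed.

End PingPong.

(** * Combing *)

Section Combing.
Local Open Scope group_scope.

Lemma braid_permM (x y : Binf) i : braid_perm (x * y) i = braid_perm x (braid_perm y i).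
Proof. by rewrite gmulfM. Qed.

Lemma braid_perm1 i : braid_perm 1 i = i.
Proof. by rewrite gmulf1. Qed.

Lemma braid_perm_tau e l i : braid_perm (sgpow e (tau l)) i = adjacent_swap l i.
Proof.
have tauE j : braid_perm (tau l) j = adjacent_swap l j by rewrite braid_perm_gen.
case: e => //=; rewrite -{1}[ i ](adjacent_swapK l) -tauE -braid_permM mulVg.
exact: braid_perm1.
Qed.

Lemma adjacent_swap_id l i : (l.+1 < i)%N -> adjacent_swap l i = i.
Proof. by move=> li; rewrite /adjacent_swap !ifF //; apply/negP => /eqP; lia. Qed.

Lemma adjacent_swap_le l i m : (l < m)%N -> (i <= m)%N -> (adjacent_swap l i <= m)%N.
Proof. by rewrite /adjacent_swap; case: eqP => [->|_] //; case: eqP => //; lia. Qed.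

Lemma braid_perm_inj (f : Binf) : injective (braid_perm f).
Proof. by have [/bij_inj] := SinfP (braid_perm f). Qed.

Lemma braid_perm_Bsub m f i : Bsub m f -> (i <= m)%N -> (braid_perm f i <= m)%N.
Proof.
move=> Bf im; elim: Bf => [|e s g [l lm ->] _ IHg]; first by rewrite braid_perm1.
by rewrite braid_permM braid_perm_tau adjacent_swap_le.
Qed.

Lemma braid_perm_Bsub_id m f i : Bsub m f -> (m < i)%N -> braid_perm f i = i.
Proof.
move=> Bf mi; elim: Bf => [|e s g [l lm ->] _ IHg]; first exact: braid_perm1.
by rewrite braid_permM IHg braid_perm_tau adjacent_swap_id //; lia.
Qed.

Lemma braid_perm_loop i n : (i < n)%N -> braid_perm (A i n) = 1.
Proof.
elim: n => // n IHn; rewrite ltnS leq_eqVlt => /predU1P[<-|i_n].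
  rewrite loop_base; apply: Sinf_eqP => j.
  by rewrite braid_permM -[tau i]/(sgpow false (tau i)) !braid_perm_tau adjacent_swapK.
by rewrite loopS // /cj !gmulfM /= IHn // mulg1 -gmulfM mulgV gmulf1.
Qed.

Lemma braid_perm_loops m n g : (m <= n)%N -> loops m n g -> braid_perm g = 1.
Proof.
move=> mn; elim=> [|e s h [i im ->] _ IHh]; first exact: gmulf1.
rewrite gmulfM /= IHh mulg1 -(braid_perm_loop (leq_trans im mn)).
case: e => //=; rewrite -[LHS]mul1g -(braid_perm_loop (leq_trans im mn)).
by rewrite -gmulfM mulgV gmulf1 /= (braid_perm_loop (leq_trans im mn)).
Qed.

(** A crossing permutes the loops up to conjugation inside the group they generate; only the
    crossings of strand [i] with a neighbour change the index. *)
Lemma cj_tau_loop e l i m n : (l.+1 < m)%N -> (m <= n)%N -> (i < m)%N ->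
  exists2 k, loops m n k &
    cj (sgpow e (tau l)) (A i n) = cj k (A (adjacent_swap l i) n).
Proof.
move=> lm mn im; rewrite /adjacent_swap.
have lA j : (j < m)%N -> loops m n (A j n).
  by move=> jm; apply: generated_incl; exists j.
have [->|il] := eqVneq i l.
  case: e; last by exists 1; [exact: generated1 | rewrite one_cj cj_loop_up //; lia].
  (* This conjugator comes from solving [cj_loop_down] for the conjugate by the inverse of
     [tau l]. *)
  exists (A l n); first by apply: lA; lia.
  apply: (can_inj (cjK (tau l))).
  rewrite /= cjKV cj_cj cj_loop_up; last by lia.
  by rewrite cj_loop_down ?cjKV //; lia.
have [->|iSl] := eqVneq i l.+1.
  case: e; last first.
    exists (A l.+1 n)^-1; last by rewrite /= cj_loop_down //; lia.
    by apply/generatedV/lA; lia.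
  exists 1; first exact: generated1.
  by rewrite one_cj /= -(@cj_loop_up l) ?cjK //; lia.
exists 1; rewrite ?one_cj; first exact: generated1.
apply: sgpow_com; case: (ltnP l.+1 i) => li; first by apply: loop_com_below; lia.
by apply: loop_com_between; lia.
Qed.

Lemma adjacent_swap_lt l i m : (l.+1 < m)%N -> (i < m)%N -> (adjacent_swap l i < m)%N.
Proof. by case: m => // m; rewrite !ltnS; exact: adjacent_swap_le. Qed.

Lemma cj_tau_loops e l m n g : (l.+1 < m)%N -> (m <= n)%N -> loops m n g ->
  loops m n (cj (sgpow e (tau l)) g).
Proof.
move=> lm mn; apply: generated_cj => _ [i im ->].
have [k lk ->] := cj_tau_loop e lm mn im; rewrite /cj.
apply: generatedM (generatedV lk); apply: generatedM => //.
by apply: generated_incl; exists (adjacent_swap l i); rewrite ?adjacent_swap_lt.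
Qed.

Lemma cj_Bsub_loop m n f i : (m < n)%N -> Bsub m f -> (i <= m)%N ->
  exists2 k, loops m.+1 n k & cj f (A i n) = cj k (A (braid_perm f i) n).
Proof.
move=> mn + im; elim=> [|e s g [l lm ->] Bg [k lk kE]].
  by exists 1; [exact: generated1 | rewrite braid_perm1].
have gm := braid_perm_Bsub Bg im.
have [//|//|//|k' lk' k'E] := @cj_tau_loop e l (braid_perm g i) m.+1 n.
exists (cj (sgpow e (tau l)) k * k').
  by apply: generatedM => //; exact: cj_tau_loops.
by rewrite cj_comp kE cj_cj k'E -cj_comp braid_permM braid_perm_tau.
Qed.

(* The parity of the number of turns around strand [j] separates the
   conjugacy classes of the loops [A i n.+1]. *)
Lemma loop_conj_inj n i j k : (i <= n)%N -> (j <= n)%N -> loops n.+1 n.+1 k ->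
  A j n.+1 = cj k (A i n.+1) -> i = j.
Proof.
move=> le_in le_jn lk jE; apply/eqP/negPn/negP => ij.
pose flip : bij bool := MkBij negbK negbK.
have [pi piE] := equivariant_map (fun l => if l == j then flip else 1) true n.
(* All loops act on [bool] by commuting flips, so [k] adds a fixed parity, which cancels in the
   conjugate. *)
have [c cE] : exists c, forall g, pi (k * g) = c (+) pi g.
  elim: lk => [|e s g [l ln ->] _ [c cE]]; first by exists false => g; rewrite mul1g.
  exists ((l == j) (+) c) => h; rewrite -mulgA piE // cE.
  by case: (l == j); case: e; case: c {cE}; case: (pi h).
have := piE j false 1 le_jn; rewrite mulg1 /= eqxx jE /cj -mulgA cE.
have := piE i false k^-1 le_in; rewrite /= (negPf ij) => -> /=.
by have := cE k^-1; rewrite mulgV => ->; case: c {cE}; case: (pi _).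
Qed.

(* [desc n k] is the descending product of [tau n.-1, ..., tau k]; it brings
   strand [k] to the last position [n]. *)
Fixpoint desc n k : Binf :=
  if n is n'.+1 then if (k <= n')%N then tau n' * desc n' k else 1 else 1.

Lemma desc_ge n k : (n <= k)%N -> desc n k = 1.
Proof. by case: n => // n nk; rewrite /= leqNgt nk. Qed.

Lemma descSl n k : (k <= n)%N -> desc n.+1 k = tau n * desc n k.
Proof. by move=> kn; rewrite /= kn. Qed.

Lemma descSr n k : (k < n)%N -> desc n k = desc n k.+1 * tau k.
Proof.
elim: n => // n IHn; rewrite ltnS leq_eqVlt => /predU1P[<-|kn].
  by rewrite descSl // !desc_ge // mulg1 mul1g.
by rewrite !descSl ?(ltnW kn) // IHn // mulgA.
Qed.

Lemma loop_desc n k : (k < n)%N -> A k n = cj (desc n k.+1) (tau k ^+ 2).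
Proof.
elim: n => // n IHn; rewrite ltnS leq_eqVlt => /predU1P[<-|kn].
  by rewrite loop_base desc_ge // one_cj.
by rewrite loopS // descSl // cj_comp IHn.
Qed.

Lemma cj_desc_below n k l : (l.+1 < k)%N -> cj (desc n k) (tau l) = tau l.
Proof.
move=> lk; elim: n => [|n IHn]; first exact: one_cj.
rewrite /=; case: leqP => kn; last exact: one_cj.
by rewrite cj_comp IHn tau_far //; lia.
Qed.

Lemma cj_desc_above n k l : (k <= l)%N -> (l.+1 < n)%N ->
  cj (desc n k) (tau l.+1) = tau l.
Proof.
move=> kl; elim: n => // n IHn; rewrite ltnS leq_eqVlt => /predU1P[<-|ln].
  rewrite !descSl ?leqW // !cj_comp.
  have com l' : (l' <= l)%N -> cj (desc l' k) (tau l.+1) = tau l.+1.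
    elim: l' => [|l' IHl] ll'; first exact: one_cj.
    rewrite /=; case: leqP => ?; last exact: one_cj.
    by rewrite cj_comp IHl ?tau_far //; lia.
  rewrite com //.
  by rewrite -cj_comp /cj -tau_braid -[_ * _ * tau l]mulgA mulgK.
by rewrite descSl ?cj_comp ?IHn ?tau_far //; lia.
Qed.

Arguments desc : simpl never.

Lemma braid_perm_desc n k : (k <= n)%N -> braid_perm (desc n k) k = n.
Proof.
elim: n => [|n IHn]; first by rewrite leqn0 => /eqP ->; exact: braid_perm1.
rewrite leq_eqVlt => /predU1P[->|kn]; first by rewrite desc_ge // braid_perm1.
by rewrite descSl // braid_permM IHn // (braid_perm_tau false) /adjacent_swap eqxx.
Qed.

(** The factors are a braid without strand [m.+1], the motion of that strand around the others, and
    a coset representative bringing strand [k] to the last place. *)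
Definition combed m f := exists b w k,
  [/\ Bsub m b, loops m.+1 m.+1 w, (k <= m.+1)%N & f = b * w * desc m.+1 k].

(** If [l] is neither [k] nor [k.-1], the crossing slides through [desc m.+1 k] and then past [w],
    which it conjugates within the loops. Otherwise it changes [k] by one and, for one of the two
    signs, leaves a loop or its inverse behind. *)
Lemma combed_tau m f e l : combed m f -> (l <= m)%N -> combed m (f * sgpow e (tau l)).
Proof.
case=> b [w [k [Bb lw km ->]]] lm.
have slide l' : (l' < m)%N -> cj (desc m.+1 k) (tau l) = tau l' ->
    combed m (b * w * desc m.+1 k * sgpow e (tau l)).
  move=> l'm dE; exists (b * sgpow e (tau l')).
  exists (cj (sgpow (~~ e) (tau l')) w); exists k; split=> //.
  - by apply: generatedM => //; apply: generated_sgpow; exists l'.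
  - exact: cj_tau_loops.
  - have -> : sgpow (~~ e) (tau l') = (sgpow e (tau l'))^-1.
      by case: e {dE}; rewrite /= ?invgK.
    rewrite /cj invgK -!mulgA mulKVg; congr (b * (w * _)).
    by rewrite -dE -cj_sgpow /cj mulgKV.
case: (ltngtP l k) => [lk|kl|lkE].
- move: lk; rewrite leq_eqVlt => /predU1P[lkE|lk]; last first.
    by apply: (slide l); [lia | exact: cj_desc_below].
  have lAl : loops m.+1 m.+1 (A l m.+1) by apply: generated_incl; exists l.
  have dE : desc m.+1 l = desc m.+1 k * tau l by rewrite -lkE -descSr.
  case: e slide => _.
    exists b, (w * (A l m.+1)^-1), l; split=> //; last 1 first.
    + rewrite loop_desc // dE -lkE -cjV /cj !mulgA mulgKV expgS expg1 invgM.
      by rewrite -!mulgA mulVg mulg1.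
    + by apply: generatedM => //; exact: generatedV.
    + by lia.
  by exists b, w, l; split=> //; [lia | rewrite /= dE mulgA].
- case: l lm slide kl => // l lm slide kl.
  by apply: (slide l) => //; apply: cj_desc_above.
- have dE : desc m.+1 k = desc m.+1 k.+1 * tau k by rewrite -descSr //; lia.
  rewrite lkE in lm *; case: e slide => _.
    by exists b, w, k.+1; split=> //=; rewrite dE mulgA mulgK.
  exists b, (w * A k m.+1), k.+1; split=> //.
    by apply: generatedM => //; apply: generated_incl; exists k.
  by rewrite loop_desc // dE /cj /= !mulgA mulgKV.
Qed.

Lemma Bsub_combed m f : Bsub m.+1 f -> combed m f.
Proof.
move=> Bf; rewrite -[f]mul1g.
have : combed m 1.
  exists 1, 1, m.+1; split=> //; [exact: generated1..|].
  by rewrite desc_ge // !mulg1.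
elim: Bf (1) => [|e s g [l lm ->] _ IHg] x cx; first by rewrite mulg1.
by rewrite mulgA; apply/IHg/combed_tau.
Qed.

(** The factors [b] and [w] fix the last place, so the permutation of [f] sends [k] there; hence
    [k = m.+1] and the third factor is trivial. *)
Lemma Bsub_fix_last m f : Bsub m.+1 f -> braid_perm f m.+1 = m.+1 ->
  exists b w, [/\ Bsub m b, loops m.+1 m.+1 w & f = b * w].
Proof.
move=> Bf fm; have [b [w [k [Bb lw km fE]]]] := Bsub_combed Bf.
exists b, w; split=> //; rewrite fE.
suff -> : k = m.+1 by rewrite desc_ge // mulg1.
apply: (@braid_perm_inj f); rewrite fm fE !braid_permM braid_perm_desc //.
by rewrite (braid_perm_loops _ lw) // (braid_perm_Bsub_id Bb).
Qed.

Lemma tau_com_Bsub m n f : (m < n)%N -> Bsub m f -> cj (tau n) f = f.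
Proof.
by move=> mn; apply: generated_com => _ [l lm ->]; apply: tau_far; lia.
Qed.

(** Strand [m.+3] does the moving. Strand [m.+2], disjoint from [f], supplies the ping-pong partner
    [A m.+2 m.+3], which is [tau m.+2 ^+ 2]. *)
Lemma powers_or_fix_last m f : Bsub m.+1 f ->
  let g t := tau m.+2 ^+ (2 * t) * A m.+1 m.+3 in
  (forall t, cj (g t) f = f) /\ braid_perm f m.+1 = m.+1 \/
  powers_family (fun t => cj (g t) f).
Proof.
move=> Bf; set x := A m.+1 m.+3 => g.
pose v := cj x f * f^-1.
have gE t : cj (g t) f = cj (tau m.+2 ^+ (2 * t)) v * f.
  rewrite cj_comp -{2}[f](cj_comX (2 * t) (tau_com_Bsub (leqnn m.+2) Bf)) -cjM.
  by rewrite /v mulgKV.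
have [//|//|//|k lk kE] := @cj_Bsub_loop m.+1 m.+3 f m.+1.
have lx : loops m.+2 m.+3 x by apply: generated_incl; exists m.+1.
have fm := braid_perm_Bsub Bf (leqnn _).
have lv : loops m.+2 m.+3 v.
  (* The commutator is [x] times the inverse of its conjugate by [f], and conjugation by [f]
     permutes the loops up to conjugation among themselves. *)
  have -> : v = x * (cj f x)^-1 by rewrite /v /cj !invgM invgK !mulgA.
  apply: generatedM => //; apply: generatedV; rewrite kE /cj.
  apply: generatedM (generatedV lk); apply: generatedM => //.
  by apply: generated_incl; exists (braid_perm f m.+1).
have [v1|v1] := pselect (v = 1); [left|right].
  split=> [t|]; first by rewrite gE v1 cj1 mul1g.
  (* Since [f] commutes with [x], the loops around [m.+1] and around its image under [f] are
     conjugate by a product of loops, so the two strands agree. *)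
  have : cj f x = x.
    by apply: cj_com; rewrite -[LHS](mulgKV f) -/v [X in X * f]v1 mul1g.
  rewrite kE => /esym /loop_conj_inj -> //; first exact: leqW.
  apply: generated_sub lk => _ [i im ->]; apply: generated_incl.
  by exists i => //; exact: leqW.
have := powers_family_transl 1 f (ping_pong lv v1).
by congr powers_family; apply/funext => t; rewrite mul1g gE.
Qed.

Lemma powers_or_smaller m f : Bsub m.+1 f -> braid_perm f m.+1 = m.+1 ->
  let g t := tau m.+1 ^+ (2 * t) in
  (forall t, cj (g t) f = f) /\ Bsub m f \/ powers_family (fun t => cj (g t) f).
Proof.
move=> Bf /(Bsub_fix_last Bf)[b [w [Bb lw ->]]] g.
have gb t : cj (g t) b = b by apply: cj_comX; exact: tau_com_Bsub Bb.
have [->|w1] := pselect (w = 1); [left|right]; first by rewrite mulg1.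
(* Conjugation by [c] turns loops of strand [m.+1] into loops of strand [m.+2], the form that
   [ping_pong] takes; [c] commutes with every [g t], so it can be undone by translations. *)
pose c := tau m.+1; pose v := cj c w.
have lv : loops m.+1 m.+2 v.
  apply: generated_cj lw => _ [i im ->]; apply: generated_incl; exists i => //.
  by rewrite [RHS]loopS.
have v1 : v <> 1 by rewrite -(cj1 c) => /(can_inj (cjK c)).
have := powers_family_transl (b * c^-1) c (ping_pong lv v1).
congr powers_family; apply/funext => t.
have gc : cj (g t) c = c by apply: cj_comX; rewrite /cj mulgK.
rewrite cjM gb -/(g t) /v cj_cj gc; move: (cj (g t) w) => u.
by rewrite /cj !mulgA !mulgKV.
Qed.

End Combing.

(** * Square sums *)

Section SquareMass.
Local Open Scope ring_scope.
Variable R : realType.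
Implicit Types (z : R[i]) (c : R).

Definition nsq z : R := normc z ^+ 2.

Lemma normc_ge0 z : 0 <= normc z.
Proof. by case: z => u v; exact: sqrtr_ge0. Qed.

Lemma nsq_ge0 z : 0 <= nsq z.
Proof. exact: sqr_ge0. Qed.

Lemma nsqM z1 z2 : nsq (z1 * z2) = nsq z1 * nsq z2.
Proof. by rewrite /nsq normcM exprMn. Qed.

Lemma normcN1 z : normc (- z) = normc z.
Proof. by case: z => u v /=; rewrite !sqrrN. Qed.

Lemma nsq_natr n : nsq n%:R = n%:R ^+ 2.
Proof. by rewrite /nsq (normcMn (1 : R[i]) n) normc1. Qed.

Lemma nsqV z : nsq z^-1 = (nsq z)^-1.
Proof. by rewrite /nsq normcV exprVn. Qed.

Lemma normc_sum (I : Type) (s : seq I) (P : pred I) (F : I -> R[i]) :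
  normc (\sum_(i <- s | P i) F i) <= \sum_(i <- s | P i) normc (F i).
Proof.
elim/big_rec2: _ => [|i u v _ uv]; first by rewrite normc0.
by apply: le_trans (le_normcD _ _) _; rewrite lerD2l.
Qed.

Lemma sqr_sum_le (I : Type) (s : seq I) (F : I -> R) :
  (\sum_(i <- s) F i) ^+ 2 <= (size s)%:R * \sum_(i <- s) F i ^+ 2.
Proof.
elim: s => [|i s IHs]; first by rewrite !big_nil expr0n mulr0.
rewrite !big_cons /=; set S := \sum_(j <- s) F j in IHs *.
set Q := \sum_(j <- s) F j ^+ 2 in IHs *; rewrite -natr1.
set n : R := (size s)%:R in IHs *.
have n0 : 0 <= n by exact: ler0n.
have Q0 : 0 <= Q by apply: sumr_ge0 => j _; exact: sqr_ge0.
(* After multiplication by [n], this is $2(nF_i)S \le (nF_i)^2 + S^2$ combined with the induction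
   hypothesis $S^2 \le nQ$. *)
suff cross : 2 * F i * S <= n * F i ^+ 2 + Q by nra.
have [n1|n1] := eqVneq n 0; first by have := sqr_ge0 S; move: IHs; rewrite n1; nra.
have np : 0 < n by rewrite lt_def n1 n0.
rewrite -(ler_pM2l np); have := sqr_ge0 (n * F i - S); nra.
Qed.

Lemma nsq_sum (I : Type) (s : seq I) (F : I -> R[i]) :
  nsq (\sum_(i <- s) F i) <= (size s)%:R * \sum_(i <- s) nsq (F i).
Proof.
apply: le_trans (sqr_sum_le _ _); rewrite lerXn2r ?nnegrE ?normc_ge0 //.
  by apply: sumr_ge0 => i _; exact: normc_ge0.
exact: normc_sum.
Qed.

Lemma sum_exclusive (V : nmodType) (I : eqType) (s : seq I) (P : pred I) (F : I -> V) :
  uniq s -> (forall i j, P i -> P j -> i = j) ->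
  \sum_(i <- s | P i) F i = 0 \/
  exists i, [/\ i \in s, P i & \sum_(i <- s | P i) F i = F i].
Proof.
move=> us Pij; have [/hasP[i si Pi]|nP] := boolP (has P s); [right|left].
  exists i; split=> //; rewrite big_mkcond (bigD1_seq i) //= Pi.
  rewrite big1 ?addr0 // => j ji; case: ifP => // Pj.
  by rewrite (Pij _ _ Pj Pi) eqxx in ji.
by apply: big_hasC.
Qed.

Section Total.
Variable G : groupType.
Implicit Types (u v : G -> R) (f : ell2 R G).

Definition total u : \bar R := (\esum_(x in [set: G]) (u x)%:E)%E.

Lemma le_total u v : (forall x, u x <= v x) -> (total u <= total v)%E.
Proof. by move=> uv; apply: le_esum => x _; rewrite lee_fin. Qed.

Lemma totalZ c u : 0 <= c -> (forall x, 0 <= u x) ->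
  (total (fun x => (c * u x)%R) <= c%:E * total u)%E.
Proof.
move=> c0 u0; apply: ge_ereal_sup => _ [X XG <-].
under eq_fsbigr do rewrite EFinM.
rewrite -ge0_mule_fsumr; last by move=> x; rewrite lee_fin.
by apply: lee_wpmul2l; rewrite ?lee_fin //; apply: ereal_sup_ubound; exists X.
Qed.

Lemma totalD u v : (forall x, 0 <= u x) -> (forall x, 0 <= v x) ->
  total (fun x => u x + v x) = (total u + total v)%E.
Proof.
move=> u0 v0; rewrite -esumD; try by move=> x _; rewrite lee_fin.
by apply: eq_esum => x _; rewrite EFinD.
Qed.

Lemma total_sum (I : choiceType) (s : seq I) (u : I -> G -> R) :
  (forall i x, 0 <= u i x) ->
  total (fun x => \sum_(i <- s) u i x) = (\sum_(i <- s) total (u i))%E.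
Proof.
move=> u0; rewrite -esum_sum; last by move=> x i _ _; rewrite lee_fin.
by apply: eq_esum => x _; rewrite sumEFin.
Qed.

Lemma total_shift h u : total (fun x => u (h * x)%g) = total u.
Proof.
rewrite /total [RHS](@reindex_esum R G G setT setT (fun x => h * x)%g) //.
split=> // [x y _ _|x _]; first exact: mulgI.
by exists (h^-1 * x)%g => //; rewrite mulKVg.
Qed.

Definition msq f : R := fine (sq_mass f).

Lemma sq_massE f : sq_mass f = (msq f)%:E.
Proof.
have /asboolP fS := ell2_summable f; rewrite fineK // ge0_fin_numE //.
by apply: esum_ge0 => x _; rewrite lee_fin sqr_ge0.
Qed.

Lemma msq_ge0 f : 0 <= msq f.
Proof.
by rewrite -lee_fin -sq_massE; apply: esum_ge0 => x _; rewrite lee_fin sqr_ge0.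
Qed.

Lemma msq_dom (I : choiceType) (s : seq I) (h : I -> ell2 R G) c f : 0 <= c ->
  (forall x, nsq (f x) <= c * \sum_(i <- s) nsq (h i x)) ->
  msq f <= c * \sum_(i <- s) msq (h i).
Proof.
move=> c0 fle; rewrite -lee_fin -sq_massE; apply: le_trans (le_total fle) _.
apply: le_trans (totalZ c0 _) _.
  by move=> x; apply: sumr_ge0 => i _; exact: nsq_ge0.
rewrite total_sum; last by move=> i x; exact: nsq_ge0.
rewrite EFinM -sumEFin le_eqVlt; apply/orP; left; apply/eqP; congr (_ * _)%E.
by apply: eq_bigr => i _; rewrite -sq_massE.
Qed.

Lemma ell2_sumE (I : Type) (s : seq I) (P : pred I) (h : I -> ell2 R G) x :
  (\sum_(i <- s | P i) h i) x = \sum_(i <- s | P i) h i x.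
Proof. by elim/big_rec2: _ => [//|i a b _ <-]. Qed.

Lemma msq_sum (I : choiceType) (s : seq I) (h : I -> ell2 R G) :
  msq (\sum_(i <- s) h i) <= (size s)%:R * \sum_(i <- s) msq (h i).
Proof. by apply: msq_dom => [|x]; rewrite ?ler0n // ell2_sumE; exact: nsq_sum. Qed.

Lemma msqZ (a : R[i]) f : msq (a *: f) <= nsq a * msq f.
Proof.
have := @msq_dom unit [:: tt] (fun=> f) (nsq a) (a *: f) (nsq_ge0 a).
by rewrite big_seq1; apply=> x; rewrite big_seq1 -nsqM.
Qed.

Lemma msqN f : msq (- f) = msq f.
Proof. by congr fine; apply: eq_esum => x _; rewrite normcN1. Qed.

Lemma msq0 : msq 0 = 0.
Proof.
apply/le_anti; rewrite msq_ge0 andbT -(scale0r 0); apply: le_trans (msqZ _ _) _.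
by rewrite /nsq normc0 expr0n mul0r.
Qed.

Lemma msq_left_regular g f : msq (left_regular g f) = msq f.
Proof. by congr fine; rewrite -[RHS](total_shift g^-1). Qed.

Lemma sum_nsq_le f (s : seq G) : uniq s -> \sum_(x <- s) nsq (f x) <= msq f.
Proof.
move=> us; rewrite -lee_fin -sq_massE -sumEFin fsbig_seq //.
apply: ereal_sup_ubound; exists [set` s]%classic => //.
by split=> //; exact: finite_seq.
Qed.

Lemma nsq_le_msq f x : nsq (f x) <= msq f.
Proof. by have := @sum_nsq_le f [:: x] isT; rewrite big_seq1. Qed.

Lemma msq_eq0 f : msq f = 0 -> f = 0.
Proof.
move=> f0; apply/val_inj/funext => x; apply: eq0_normc; apply/eqP.
by rewrite -sqrf_eq0 eq_le sqr_ge0 andbT -f0; exact: nsq_le_msq.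
Qed.

Lemma left_regularM g h f :
  left_regular (g * h)%g f = left_regular g (left_regular h f).
Proof. by apply/val_inj/funext => x /=; rewrite invgM mulgA. Qed.

Lemma left_regular1 f : left_regular 1%g f = f.
Proof. by apply/val_inj/funext => x /=; rewrite invg1 mul1g. Qed.

Lemma left_regular_linear g : linear (@left_regular R G g).
Proof. by move=> a f h; exact: val_inj. Qed.

Lemma left_regular_sum (I : Type) (s : seq I) (h : I -> ell2 R G) g :
  left_regular g (\sum_(i <- s) h i) = \sum_(i <- s) left_regular g (h i).
Proof.
by apply/val_inj/funext => x; rewrite /= ell2_sumE [RHS]ell2_sumE.
Qed.

(* Powers: at each point at most one summand has its point in [D t], and all the
   others have their argument in the disjoint sets [E t]. *)
Lemma powers_estimate (h : nat -> G) N f : powers_family h ->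
  msq (\sum_(t <- iota 0 N) left_regular (h t) f) <= (4 * N)%:R * msq f.
Proof.
case=> D [E [D0 E0 hDE]].
have excl (S : nat -> set G) x :
    (forall s t, (s < t)%N -> S s `&` S t = set0)%classic ->
    forall s t, `[< S s x >] -> `[< S t x >] -> s = t.
  move=> S0 s t /asboolP ss /asboolP tt; case: (ltngtP s t) => // st.
    by have /seteqP[/(_ x)] := S0 _ _ st; case; split.
  by have /seteqP[/(_ x)] := S0 _ _ st; case; split.
pose u1 t x := nsq (f ((h t)^-1 * x)%g).
pose w t y := if `[< E t y >] then nsq (f y) else 0.
pose u2 t x := w t ((h t)^-1 * x)%g.
have w0 t y : 0 <= w t y by rewrite /w; case: ifP => _ //; exact: nsq_ge0.
have u10 t x : 0 <= u1 t x by exact: nsq_ge0.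
have u20 t x : 0 <= u2 t x by exact: w0.
(* At most one [t] has [x] in [D t]. The remaining terms see [f] only on [E t], and Cauchy-Schwarz
   costs them a factor [N]. *)
have bound x : nsq ((\sum_(t <- iota 0 N) left_regular (h t) f) x) <=
    \sum_(t <- iota 0 N) (2 * u1 t x + (2 * N)%:R * u2 t x).
  rewrite ell2_sumE (bigID (fun t => `[< D t x >])) /=.
  set z1 := \sum_(t <- _ | _) _; set z2 := \sum_(t <- _ | _) _.
  have z12 : nsq (z1 + z2) <= 2 * (nsq z1 + nsq z2).
    by have := nsq_sum [:: z1; z2] id; rewrite !big_cons !big_nil !addr0.
  have z1le : nsq z1 <= \sum_(t <- iota 0 N) u1 t x.
    rewrite /z1; have [->|[t [tN _ ->]]] :=
        sum_exclusive (fun t => left_regular (h t) f x) (iota_uniq 0 N) (excl D x D0).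
      by rewrite /nsq normc0 expr0n sumr_ge0.
    by rewrite (bigD1_seq t) ?iota_uniq //= lerDl sumr_ge0.
  have z2le : nsq z2 <= N%:R * \sum_(t <- iota 0 N) u2 t x.
    rewrite /z2 big_mkcond /=; apply: le_trans (nsq_sum _ _) _.
    rewrite size_iota ler_wpM2l ?ler0n // ler_sum // => t _.
    case: asboolP => /= Dtx; first by rewrite /nsq normc0 expr0n; exact: w0.
    rewrite /u2 /w; case: asboolP => // Etx.
    by case: Dtx; have := hDE t _ Etx; rewrite mulKVg.
  apply: le_trans z12 _; rewrite big_split /= -!mulr_sumr natrM -mulrA -mulrDr.
  by rewrite ler_wpM2l // lerD.
rewrite -lee_fin -sq_massE; apply: le_trans (le_total bound) _.
rewrite total_sum; last first.
  by move=> t x; apply: addr_ge0; apply: mulr_ge0 => //; exact: ler0n.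
have tot t : (total (fun x => (2 * u1 t x + (2 * N)%:R * u2 t x)%R) <=
    (2 * msq f)%:E + (2 * N)%:R%:E * total (w t))%E.
  rewrite totalD; try by move=> x; apply: mulr_ge0 => //; exact: ler0n.
  apply: leeD; last by rewrite -(total_shift (h t)^-1 (w t)); exact: totalZ.
  rewrite EFinM -sq_massE -[sq_mass f](total_shift (h t)^-1).
  by apply: totalZ => // x; exact: nsq_ge0.
apply: le_trans (lee_sum _ (fun t _ => tot t)) _.
rewrite big_split /= sumEFin -ge0_sume_distrr; last first.
  by move=> t _; apply: esum_ge0 => x _; rewrite lee_fin.
rewrite -total_sum //.
(* The sets [E t] are disjoint, so the masses of [f] on them add up to at most [msq f]. *)
have wle : (total (fun x => (\sum_(t <- iota 0 N) w t x)%R) <= (msq f)%:E)%E.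
  rewrite -sq_massE; apply: le_total => x; rewrite -big_mkcond.
  have [->|[t [_ _ ->]] //] :=
    sum_exclusive (fun=> nsq (f x)) (iota_uniq 0 N) (excl E x E0).
  exact: nsq_ge0.
apply: le_trans (leeD (lexx _) (lee_wpmul2l _ wle)) _; first by rewrite lee_fin.
rewrite -EFinM -EFinD lee_fin big_const_seq count_predT size_iota iter_addr_0.
by rewrite -mulr_natr !natrM; lra.
Qed.

End Total.
End SquareMass.

(** * Averages of conjugates *)

Section Averaging.
Local Open Scope ring_scope.
Variables (R : realType) (G : groupType).
Implicit Types (L : seq G) (e : R).

(** The average of the conjugates of [x] has squared norm at most [e]; the sum is left undivided,
    hence the squared length. *)
Definition average_le L (x : G) e := forall f : ell2 R G,
  msq (\sum_(g <- L) left_regular (cj g x) f) <= e * (size L)%:R ^+ 2 * msq f.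

Definition list_mul L2 L1 := [seq (h * g)%g | h <- L2, g <- L1].

Lemma left_regular_cj h g x (f : ell2 R G) : left_regular (cj (h * g)%g x) f =
  left_regular h (left_regular (cj g x) (left_regular h^-1%g f)).
Proof. by rewrite cj_comp -!left_regularM /cj !mulgA. Qed.

(** Conjugating by unitaries and averaging once more does not increase the norm. *)
Lemma average_le_list_mull L2 L1 x e :
  average_le L1 x e -> average_le (list_mul L2 L1) x e.
Proof.
move=> L1x f; rewrite big_allpairs_dep size_allpairs.
under eq_bigr => h _ do under eq_bigr => g _ do rewrite left_regular_cj.
under eq_bigr => h _ do rewrite -left_regular_sum.
apply: le_trans (msq_sum _ _) _.
apply: (@le_trans _ _ ((size L2)%:R * \sum_(h <- L2) (e * (size L1)%:R ^+ 2 * msq f))).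
  rewrite ler_wpM2l ?ler0n // ler_sum // => h _; rewrite msq_left_regular.
  by apply: le_trans (L1x _) _; rewrite msq_left_regular.
by rewrite big_const_seq count_predT iter_addr_0 -mulr_natr natrM; lra.
Qed.

(** The inner average over [L1] does nothing to [x], so only the outer one counts. *)
Lemma average_le_list_mulr L2 L1 x e : (forall g, g \in L1 -> cj g x = x) ->
  average_le L2 x e -> average_le (list_mul L2 L1) x e.
Proof.
move=> xL1 L2x f; rewrite big_allpairs_dep size_allpairs.
have -> : \sum_(h <- L2) \sum_(g <- L1) left_regular (cj (h * g)%g x) f =
    (size L1)%:R *: \sum_(h <- L2) left_regular (cj h x) f.
  rewrite scaler_sumr; apply: eq_bigr => h _; rewrite scaler_nat.
  under eq_big_seq => g gL do rewrite cj_comp xL1 //.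
  by rewrite big_const_seq count_predT iter_addr_0.
apply: le_trans (msqZ _ _) _; rewrite nsq_natr.
apply: le_trans (ler_wpM2l (sqr_ge0 _) (L2x f)) _.
by rewrite natrM; lra.
Qed.

(** [G] stands for both groups at once. All conjugators are pure braids, so it suffices that the
    image of [emb] contains these. *)
Variable emb : G -> Binf.
Hypothesis embM : {morph emb : x y / (x * y)%g}.
Hypothesis emb_inj : injective emb.
Hypothesis emb_pure : forall g, braid_perm g = 1%g -> exists x, emb x = g.

Let emb1 : emb 1%g = 1%g.
Proof. by apply: (mulgI (emb 1%g)); rewrite -embM !mulg1. Qed.

Let embV : {morph emb : x / x^-1%g}.
Proof. by move=> x; apply: (mulgI (emb x)); rewrite -embM !mulgV. Qed.

Let emb_cj x y : emb (cj x y) = cj (emb x) (emb y).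
Proof. by rewrite /cj !embM embV. Qed.

Let powers_family_pull (h : nat -> G) :
  powers_family (fun t => emb (h t)) -> powers_family h.
Proof.
case=> D [E [D0 E0 hDE]].
exists (fun t => emb @^-1` D t)%classic, (fun t => emb @^-1` E t)%classic.
split=> [s t /D0 st|s t /E0 st|t g /= /hDE]; last by rewrite embM.
- by rewrite -preimage_setI st preimage_set0.
- by rewrite -preimage_setI st preimage_set0.
Qed.

Let powers_average (g : nat -> G) N x e : powers_family (fun t => cj (g t) x) ->
  (4 * N)%:R <= e * N%:R ^+ 2 -> average_le [seq g t | t <- iota 0 N] x e.
Proof.
move=> pg Ne f; rewrite big_map size_map size_iota.
apply: le_trans (powers_estimate N f pg) _.
by rewrite ler_wpM2r ?msq_ge0.
Qed.

(** Conjugation is by [L1], then [L2], then the list [L0] of the induction hypothesis: each [x]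
    stays fixed until the stage that makes it small, and later stages do no harm. *)
Lemma braid_averaging e m : 0 < e -> exists L, (0 < size L)%N /\
  forall x, Bsub m (emb x) -> x <> 1%g -> average_le L x e.
Proof.
move=> e0; elim: m => [|m [L0 [L0_gt0 L0x]]].
  exists [:: 1%g]; split=> // x Bx x1; case: x1; apply: emb_inj; rewrite emb1.
  by elim: Bx => // ? ? ? [].
(* The constant 4 is that of [powers_estimate]. *)
pose N := (Num.truncn (4 / e)).+1.
have Ne : (4 * N)%:R <= e * N%:R ^+ 2.
  have : 4 / e < N%:R by exact: truncnS_gt.
  rewrite ltr_pdivrMr // => lt4; rewrite natrM expr2 mulrA ler_wpM2r ?ler0n //.
  by rewrite [e * _]mulrC ltW.
have loopX n t : braid_perm (tau n ^+ (2 * t))%g = 1%g.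
  apply: (@braid_perm_loops n.+1 n.+1) => //; rewrite expgM -loop_base.
  by apply: generatedX; apply: generated_incl; exists n.
have /choice[g1 g1E] t : exists x, emb x = (tau m.+2 ^+ (2 * t) * A m.+1 m.+3)%g.
  by apply: emb_pure; rewrite gmulfM /= loopX braid_perm_loop // mulg1.
have /choice[g2 g2E] t : exists x, emb x = (tau m.+1 ^+ (2 * t))%g.
  exact/emb_pure/loopX.
pose L1 := [seq g1 t | t <- iota 0 N]; pose L2 := [seq g2 t | t <- iota 0 N].
exists (list_mul L0 (list_mul L2 L1)).
split; first by rewrite !size_allpairs !size_map !size_iota !muln_gt0 L0_gt0.
move=> x Bx x1.
have fix1 : (forall t, cj (g1 t) x = x) -> forall g, g \in L1 -> cj g x = x.
  by move=> gx g /mapP[t _ ->].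
have fix2 : (forall t, cj (g2 t) x = x) -> forall g, g \in L2 -> cj g x = x.
  by move=> gx g /mapP[t _ ->].
case: (powers_or_fix_last Bx) => [[gx xm]|pg]; last first.
  do 2![apply: average_le_list_mull]; apply: powers_average Ne.
  apply: powers_family_pull; move: pg; congr powers_family.
  by apply/funext => t; rewrite emb_cj g1E.
have {}fix1 : forall g, g \in L1 -> cj g x = x.
  by apply: fix1 => t; apply: emb_inj; rewrite emb_cj g1E.
case: (powers_or_smaller Bx xm) => [[g2x Bmx]|pg]; last first.
  apply: average_le_list_mull; apply: average_le_list_mulr => //.
  apply: powers_average Ne; apply: powers_family_pull; move: pg.
  by congr powers_family; apply/funext => t; rewrite emb_cj g2E.
apply: average_le_list_mulr (L0x _ Bmx x1) => _ /allpairsP[[h g] /= [hL gL ->]].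
rewrite cj_comp fix1 //; apply: fix2 hL => t.
by apply: emb_inj; rewrite emb_cj g2E.
Qed.

Lemma braid_averaging_seq e (s : seq G) : 0 < e -> exists L, (0 < size L)%N /\
  forall x, x \in s -> x <> 1%g -> average_le L x e.
Proof.
move=> e0.
have [m Bm] : exists m, forall x, x \in s -> Bsub m (emb x).
  elim: s => [|x s [m IHs]]; first by exists 0%N.
  have [m' Bm'] := Binf_Bsub (emb x).
  have mono k : (k <= maxn m m')%N -> forall y, Bsub k y -> Bsub (maxn m m') y.
    move=> km y; apply: generated_sub => _ [l lk ->]; apply: generated_incl.
    by exists l => //; exact: leq_trans km.
  exists (maxn m m') => y; rewrite inE => /predU1P[->|/IHs].
    by apply: mono Bm'; exact: leq_maxr.
  by apply: mono; exact: leq_maxl.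
have [L [L0 Lx]] := braid_averaging m e0.
by exists L; split=> // x /Bm; exact: Lx.
Qed.

End Averaging.

(** * Simplicity *)

Section Simplicity.
Local Open Scope ring_scope.
Variables (R : realType) (G : groupType).
Local Notation V := (ell2 R G).
Implicit Types (T S : V -> V) (f : V) (e : R).

Definition group_sum (s : seq (R[i] * G)) : V -> V :=
  \sum_(p <- s) p.1 *: left_regular p.2.

Lemma group_sumE s f : group_sum s f = \sum_(p <- s) p.1 *: left_regular p.2 f.
Proof. by rewrite /group_sum fct_sumE. Qed.

Lemma linear_op0 T : linear T -> T 0 = 0.
Proof.
move=> linT; apply: (addrI (T 0)).
by have := linT 1 0 0; rewrite !scale1r !addr0 => <-.
Qed.

Lemma linear_opZ T a f : linear T -> T (a *: f) = a *: T f.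
Proof. by move=> linT; have := linT a f 0; rewrite (linear_op0 linT) !addr0. Qed.

Lemma linear_group_sum s : linear (group_sum s).
Proof.
move=> a f g; rewrite !group_sumE scaler_sumr -big_split; apply: eq_bigr => p _ /=.
by rewrite left_regular_linear scalerDr !scalerA mulrC.
Qed.

Lemma linear_sub_op T S : linear T -> linear S -> linear (T - S).
Proof.
move=> linT linS a f g.
rewrite -[LHS]/(T (a *: f + g) - S (a *: f + g)).
rewrite -[RHS]/(a *: (T f - S f) + (T g - S g)).
rewrite linT linS.
by rewrite scalerBr opprD addrACA.
Qed.

Lemma msq_op_le T e f : linear T -> (op_norm T < e%:E)%E -> msq (T f) <= e ^+ 2 * msq f.
Proof.
move=> linT Te; have [f0|fn0] := eqVneq (msq f) 0.
  by rewrite (msq_eq0 f0) (linear_op0 linT) msq0 mulr0.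
have fp : 0 < msq f by rewrite lt_def fn0 msq_ge0.
pose c := Num.sqrt (msq f); pose k : R[i] := (c%:C)^-1%C.
have c0 : 0 < c by rewrite sqrtr_gt0.
have kE : nsq k = (msq f)^-1.
  rewrite nsqV /nsq /= expr0n addr0 sqrtr_sqr ger0_norm ?(ltW c0) //.
  by rewrite sqr_sqrtr // ltW.
have le1 : ell2_norm (k *: f) <= 1.
  rewrite -sqrtr1 ler_wsqrtr //; apply: le_trans (msqZ _ _) _.
  by rewrite kE mulVf.
have Tle : ell2_norm (T (k *: f)) <= e.
  rewrite -lee_fin; apply: le_trans (ltW Te).
  by apply: ereal_sup_ubound; exists (k *: f).
have Tke : msq (T (k *: f)) <= e ^+ 2.
  rewrite -[msq _]sqr_sqrtr ?msq_ge0 // lerXn2r // nnegrE ?sqrtr_ge0 //.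
  exact: le_trans (sqrtr_ge0 _) Tle.
have -> : T f = k^-1 *: T (k *: f).
  rewrite linear_opZ // scalerA mulVf ?scale1r // invr_eq0.
  by apply/eqP => /(congr1 (@complex.Re R)) /= c00; rewrite c00 ltxx in c0.
apply: le_trans (msqZ _ _) _; rewrite nsqV kE invrK mulrC ler_wpM2r //.
exact: ltW.
Qed.

Lemma op_norm_le T e : 0 <= e -> (forall f, msq (T f) <= e ^+ 2 * msq f) ->
  (op_norm T <= e%:E)%E.
Proof.
move=> e0 Te; apply: ge_ereal_sup => _ [f /= f1 <-]; rewrite lee_fin.
have f1' : msq f <= 1.
  by rewrite -[msq f]sqr_sqrtr ?msq_ge0 // exprn_ile1 ?sqrtr_ge0.
rewrite -[e]ger0_norm // -sqrtr_sqr ler_wsqrtr //.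
apply: le_trans (Te f) _; rewrite -[X in _ <= X]mulr1.
by rewrite ler_wpM2l ?sqr_ge0.
Qed.

Lemma sq_mass_delta : sq_mass (fun x : G => (x == 1%g)%:R : R[i]^o) = 1%E.
Proof.
rewrite -[RHS](@esum_set1 R G 1%g (fun=> 1%E)) ?lee01 // [RHS]esum_mkcond.
apply: eq_esum => x _; case: (eqVneq x 1%g) => [->|x1].
  by rewrite mem_set // mulr1n normc1 expr1n.
by rewrite memNset ?mulr0n ?normc0 ?expr0n //; apply/eqP.
Qed.

Lemma ell2_delta_subproof : (fun x : G => (x == 1%g)%:R : R[i]^o) \in @sq_summable R G.
Proof. by apply/asboolP; rewrite sq_mass_delta ltry. Qed.

(** The values of [T ell2_delta] are the Fourier coefficients of [T]; the one at [1] is the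
    trace. *)
Definition ell2_delta : V := MkEll2 ell2_delta_subproof.

Lemma msq_delta : msq ell2_delta = 1.
Proof. by rewrite /msq sq_mass_delta. Qed.

Lemma group_sum_delta s x : group_sum s ell2_delta x = \sum_(p <- s | p.2 == x) p.1.
Proof.
rewrite group_sumE ell2_sumE [RHS]big_mkcond; apply: eq_bigr => p _ /=.
rewrite -[LHS]/(p.1 * (p.2^-1 * x == 1)%g%:R).
rewrite (can2_eq (mulKVg _) (mulKg _)) mulg1 eq_sym.
by case: eqP; rewrite ?mulr1 ?mulr0.
Qed.

Lemma group_sum_point s f x : group_sum s f x =
  \sum_(h <- undup [seq p.2 | p <- s]) group_sum s ell2_delta h * f (h^-1 * x)%g.
Proof.
under eq_bigr => h _ do rewrite group_sum_delta mulr_suml big_mkcond.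
rewrite exchange_big group_sumE ell2_sumE /= !big_seq; apply: eq_bigr => p ps.
rewrite (bigD1_seq p.2) ?undup_uniq ?mem_undup ?map_f //= eqxx big1 ?addr0 //.
by move=> h hp; rewrite eq_sym (negPf hp).
Qed.

(** Cauchy-Schwarz for the convolution, in the form $uv \le u^2/e + e v^2$ with a free parameter. *)
Lemma group_sum_point_le s f x e : 0 < e ->
  normc (group_sum s f x) <= msq (group_sum s ell2_delta) / e + e * msq f.
Proof.
move=> e0; rewrite group_sum_point; set H := undup _.
have uH : uniq H := undup_uniq _.
apply: le_trans (normc_sum _ _ _) _.
apply: (@le_trans _ _ (\sum_(h <- H)
  (nsq (group_sum s ell2_delta h) / e + e * nsq (f (h^-1 * x)%g)))).
  apply: ler_sum => h _; rewrite normcM /nsq; set u := normc _; set v := normc _.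
  have -> : u ^+ 2 / e + e * v ^+ 2 = ((u - e * v) ^+ 2 + 2 * e * (u * v)) / e.
    by field; rewrite gt_eqF.
  have uv0 : 0 <= u * v by rewrite mulr_ge0 ?normc_ge0.
  by rewrite ler_pdivlMr //; have := sqr_ge0 (u - e * v); nra.
rewrite big_split -mulr_suml -mulr_sumr lerD //.
  by rewrite ler_wpM2r ?invr_ge0 ?(ltW e0) // sum_nsq_le.
rewrite ler_wpM2l ?(ltW e0) //.
rewrite -(big_map (fun h => h^-1 * x)%g xpredT (fun y => nsq (f y))).
apply: sum_nsq_le; rewrite map_inj_uniq // => h h' /mulIg; exact: invg_inj.
Qed.

(** An approximating group sum has small Fourier coefficients in square mean, so by
    [group_sum_point_le] its values on [f] are small at every point, and so are those of [T]. *)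
Lemma reduced_Cstar_delta T :
  @reduced_Cstar R G T -> T ell2_delta = 0 -> T = 0.
Proof.
move=> [[linT _] Tapp] Td0; apply/funext => f; apply/val_inj/funext => x /=.
apply: eq0_normc; apply/eqP; rewrite eq_le normc_ge0 andbT.
apply/ler_addgt0Pl => e e0; rewrite addr0.
(* The approximation error is at most [d * (1 + msq f)] and the group sum contributes at most
   [d + d * msq f], which together make [d * c = e]. *)
pose c := 2 + 2 * msq f; have m0 := msq_ge0 f.
have c0 : 0 < c by rewrite /c; lra.
pose d := e / c; have d0 : 0 < d by rewrite divr_gt0.
have [_ [s ->] TS] := Tapp d d0; rewrite -/(group_sum s) in TS *.
have linTS := linear_sub_op linT (@linear_group_sum s).
have dS : msq (group_sum s ell2_delta) <= d ^+ 2.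
  have := msq_op_le ell2_delta linTS TS; rewrite msq_delta mulr1.
  by rewrite -[X in msq X]/(T ell2_delta - _) Td0 sub0r msqN.
have Sx := group_sum_point_le s f x d0.
have TSx : normc ((T - group_sum s) f x) <= d * (1 + msq f).
  have d1 : 0 <= d * (1 + msq f) by rewrite mulr_ge0 ?(ltW d0) //; lra.
  rewrite -(@ler_pXn2r _ 2) ?nnegrE ?normc_ge0 //.
  apply: le_trans (nsq_le_msq ((T - group_sum s) f) x) _.
  apply: le_trans (msq_op_le f linTS TS) _.
  rewrite [leRHS]exprMn; apply: ler_wpM2l; first exact: sqr_ge0.
  by nra.
have -> : T f x = (T - group_sum s) f x + group_sum s f x.
  by rewrite -[X in X + _]/(T f x - _) subrK.
apply: le_trans (le_normcD _ _) _; apply: le_trans (lerD TSx Sx) _.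
have dSd : msq (group_sum s ell2_delta) / d <= d by rewrite ler_pdivrMr.
have -> : e = d * c by rewrite /d mulfVK // gt_eqF.
rewrite /c; nra.
Qed.

End Simplicity.

(** * Averaging implies simplicity *)

Section AveragingSimple.
Local Open Scope ring_scope.
Variables (R : realType) (G : groupType).
Local Notation V := (ell2 R G).

Lemma op_norm_lt (T : V -> V) (e : R) : 0 < e ->
  (forall f, msq (T f) <= (e / 2) ^+ 2 * msq f) -> (op_norm T < e%:E)%E.
Proof.
move=> e0 Te; apply: (@le_lt_trans _ _ (e / 2)%:E); last by rewrite lte_fin; lra.
by apply: op_norm_le Te; lra.
Qed.

Lemma left_regular_reduced g : @reduced_Cstar R G (left_regular g).
Proof.
split; first split; first exact: left_regular_linear.
  apply: (@le_lt_trans _ _ 1%:E); last exact: ltry.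
  by apply: op_norm_le => // f; rewrite msq_left_regular expr1n mul1r.
move=> e e0; exists (left_regular g).
  by exists [:: (1, g)]; rewrite big_seq1 scale1r.
apply: op_norm_lt => // f; rewrite subrr msq0.
by rewrite mulr_ge0 ?sqr_ge0 ?msq_ge0.
Qed.

Section Ideal.
Variables (C I : set (V -> V)).
Hypothesis idI : closed_ideal C I.

Lemma ideal_scale a T : I T -> I (a *: T).
Proof. by move=> IT; have := ideal_linear idI a IT (ideal_zero idI); rewrite addr0. Qed.

Lemma ideal_sum (J : Type) (s : seq J) (F : J -> V -> V) :
  (forall j, I (F j)) -> I (\sum_(j <- s) F j).
Proof.
move=> IF; elim/big_rec: _ => [|j T _ IT]; first exact: ideal_zero idI.
by have := ideal_linear idI 1 (IF j) IT; rewrite scale1r.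
Qed.
End Ideal.

Hypothesis averaging : forall (e : R) (s : seq G), 0 < e ->
  exists L : seq G, (0 < size L)%N /\
    forall x, x \in s -> x <> 1%g -> @average_le R G L x e.

Definition mean (L : seq G) (T : V -> V) : V -> V :=
  (size L)%:R^-1 *: \sum_(g <- L) (left_regular g \o T \o left_regular g^-1%g).

Lemma meanE L T f : mean L T f =
  (size L)%:R^-1 *: \sum_(g <- L) left_regular g (T (left_regular g^-1%g f)).
Proof. by rewrite /mean -[LHS]/(_ *: (_ f)) fct_sumE. Qed.

Lemma msq_mean_le L T c f : (0 < size L)%N -> (forall f, msq (T f) <= c * msq f) ->
  msq (mean L T f) <= c * msq f.
Proof.
move=> L0 Tc; have n0 : (0 : R) < (size L)%:R by rewrite ltr0n.
rewrite meanE; apply: le_trans (msqZ _ _) _; rewrite nsqV nsq_natr.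
apply: (@le_trans _ _ (((size L)%:R ^+ 2)^-1 *
  ((size L)%:R * \sum_(g <- L) (c * msq f)))).
  rewrite ler_wpM2l ?invr_ge0 ?sqr_ge0 //; apply: le_trans (msq_sum _ _) _.
  rewrite ler_wpM2l ?ler0n // ler_sum // => g _; rewrite msq_left_regular.
  by apply: le_trans (Tc _) _; rewrite msq_left_regular.
rewrite big_const_seq count_predT iter_addr_0 -mulr_natr.
by rewrite le_eqVlt; apply/orP; left; apply/eqP; field; rewrite gt_eqF.
Qed.

(** Conjugation fixes the terms at [1], whose coefficients add up to the trace. *)
Lemma mean_group_sum L s f : (0 < size L)%N -> mean L (group_sum s) f =
  group_sum s (ell2_delta R G) 1%g *: f +
  \sum_(p <- s | p.2 != 1%g) (p.1 / (size L)%:R) *: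
    \sum_(g <- L) left_regular (cj g p.2) f.
Proof.
move=> L0; rewrite meanE.
have n0 : (size L)%:R != 0 :> R[i] by rewrite pnatr_eq0 -lt0n.
have -> : \sum_(g <- L) left_regular g (group_sum s (left_regular g^-1%g f)) =
    \sum_(p <- s) p.1 *: \sum_(g <- L) left_regular (cj g p.2) f.
  under eq_bigr => g _ do rewrite group_sumE left_regular_sum.
  rewrite exchange_big; apply: eq_bigr => p _.
  rewrite scaler_sumr; apply: eq_bigr => g _.
  by rewrite /cj !left_regularM; apply/val_inj.
rewrite (bigID (fun p => p.2 == 1%g)) /= scalerDr; congr (_ + _); last first.
  rewrite scaler_sumr; apply: eq_bigr => p _.
  by rewrite scalerA mulrC.
rewrite group_sum_delta scaler_suml scaler_sumr; apply: eq_bigr => p /eqP ->.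
under eq_bigr => g _ do rewrite cj1 left_regular1.
rewrite big_const_seq count_predT iter_addr_0 -[f *+ _]scaler_nat !scalerA.
by rewrite mulrAC mulVf ?mul1r.
Qed.

Lemma msq_mean_group_sum s e : 0 < e -> exists L, (0 < size L)%N /\ forall f,
  msq (mean L (group_sum s) f - group_sum s (ell2_delta R G) 1%g *: f) <= e * msq f.
Proof.
(* [c] is the factor that Cauchy-Schwarz produces from the coefficients; dividing by [1 + c] covers
   the case [c = 0]. *)
move=> e0; pose c : R := (size s)%:R * \sum_(p <- s) nsq p.1.
have c0 : 0 <= c by rewrite mulr_ge0 ?ler0n // sumr_ge0 // => p _; exact: nsq_ge0.
have c1 : 0 < 1 + c by lra.
have [L [L0 Lav]] := averaging [seq p.2 | p <- s] (divr_gt0 e0 c1).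
exists L; split=> // f; rewrite mean_group_sum // addrC addKr big_mkcond /=.
have n0 : (0 : R) < (size L)%:R by rewrite ltr0n.
apply: le_trans (msq_sum _ _) _.
apply: (@le_trans _ _ ((size s)%:R * \sum_(p <- s) (nsq p.1 * (e / (1 + c) * msq f)))).
  rewrite ler_wpM2l ?ler0n // big_seq [leRHS]big_seq ler_sum // => p ps.
  have em : 0 <= e / (1 + c) * msq f by rewrite mulr_ge0 ?msq_ge0 ?divr_ge0 ?ltW.
  case: eqP => [_|p1] /=; first by rewrite msq0 mulr_ge0 ?nsq_ge0.
  apply: le_trans (msqZ _ _) _; rewrite nsqM nsqV nsq_natr -mulrA.
  rewrite ler_wpM2l ?nsq_ge0 // mulrC ler_pdivrMr ?exprn_gt0 //.
  apply: le_trans (Lav _ (map_f _ ps) p1 f) _.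
  by rewrite mulrAC.
rewrite -mulr_suml mulrA -/c mulrA ler_wpM2r ?msq_ge0 //.
by rewrite mulrA ler_pdivrMr // mulrC ler_wpM2l ?(ltW e0) //; lra.
Qed.

Lemma Cstar_simple_of_averaging : Cstar_simple R G.
Proof.
move=> I idI; have [allz|] := pselect (forall T, I T -> T = 0).
  left; apply/seteqP; split=> [T /allz|_ ->] //; exact: ideal_zero idI.
move=> /existsNP[T0 /not_implyP[IT0 T0n0]]; right.
have [h h0] : exists h, T0 (ell2_delta R G) h <> 0.
  apply/existsNP => T00; apply: T0n0.
  apply: (reduced_Cstar_delta (ideal_sub idI IT0)).
  by apply/val_inj/funext => x; exact: T00.
(* Translation by the inverse of [h] moves a nonzero coefficient to [1], and scaling normalises the
   trace. *)
have [T IT T1] : exists2 T, I T & T (ell2_delta R G) 1%g = 1.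
  exists ((T0 (ell2_delta R G) h)^-1 *: (left_regular h^-1%g \o T0)).
    apply: (ideal_scale idI); apply: (ideal_left idI) IT0.
    exact: left_regular_reduced.
  rewrite -[LHS]/((T0 (ell2_delta R G) h)^-1 * T0 (ell2_delta R G) (h^-1^-1 * 1)%g).
  by rewrite invgK mulg1 mulVf //; apply/eqP.
suff I1 : I id.
  apply/seteqP; split; first exact: ideal_sub idI.
  by move=> S AS; have := ideal_left idI AS I1.
apply: (ideal_closed idI); split.
  split; first by [].
  apply: (@le_lt_trans _ _ 1%:E); last exact: ltry.
  by apply: op_norm_le => // f; rewrite expr1n mul1r.
move=> e e0; have [[linT _] Tapp] := ideal_sub idI IT.
(* Three errors of squared norm at most $d^2$ add up to at most $3 \cdot 3d^2 = (e/2)^2$. *)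
pose d := e / 6; have d0 : 0 < d by rewrite /d; lra.
have [_ [s ->] TS] := Tapp d d0; rewrite -/(group_sum s) in TS.
have linTS := linear_sub_op linT (@linear_group_sum R G s).
have TSle f := msq_op_le f linTS TS.
have d20 : 0 < d ^+ 2 by rewrite exprn_gt0.
have [L [L0 Ls]] := msq_mean_group_sum s d20.
exists (mean L T).
  apply: (ideal_scale idI); apply: (ideal_sum idI) => g.
  apply: (ideal_right idI (left_regular_reduced _)).
  exact: (ideal_left idI (left_regular_reduced _)).
apply: op_norm_lt => // f.
pose t := group_sum s (ell2_delta R G) 1%g.
have t1 : nsq (1 - t) <= d ^+ 2.
  have := TSle (ell2_delta R G); rewrite msq_delta mulr1; apply: le_trans.
  have -> : 1 - t = (T - group_sum s) (ell2_delta R G) 1%g.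
    by rewrite -[RHS]/(T (ell2_delta R G) 1%g - t) T1.
  exact: nsq_le_msq.
(* The errors come from approximating [T] by a group sum, from averaging that sum, and from its
   trace [t] being only close to [1]. *)
have split3 : (id - mean L T) f = \sum_(u <- [:: - mean L (T - group_sum s) f;
    - (mean L (group_sum s) f - t *: f); (1 - t) *: f]) u.
  rewrite !big_cons big_nil addr0 -[LHS]/(f - mean L T f).
  have -> : mean L T f = mean L (T - group_sum s) f + mean L (group_sum s) f.
    rewrite !meanE -scalerDr -big_split /=; congr (_ *: _); apply: eq_bigr => g _.
    by apply/val_inj/funext => x /=; rewrite subrK.
  move: (mean L _ f) (mean L _ f) => u v; rewrite scalerBl scale1r opprB.
  by rewrite [t *: f - _ + _]addrC [f - _ + _]addrA subrK addrCA opprD.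
rewrite split3; apply: le_trans (msq_sum _ id) _; rewrite !big_cons big_nil !msqN /=.
have m0 := msq_ge0 f.
have b1 := msq_mean_le f L0 TSle; have b2 := Ls f.
have b3 : msq ((1 - t) *: f) <= d ^+ 2 * msq f.
  by apply: le_trans (msqZ _ _) _; rewrite ler_wpM2r.
have -> : (e / 2) ^+ 2 = 9 * d ^+ 2 by rewrite /d; field.
by rewrite -/t in b2; lra.
Qed.

End AveragingSimple.

Theorem theorem7p2 (R : realType) : Cstar_simple R Pinf /\ Cstar_simple R Binf.
Proof.
split; apply: Cstar_simple_of_averaging => e s e0.
  apply: (@braid_averaging_seq R Pinf Pinf_val) => //; first exact: val_inj.
  by move=> g /eqP pg; exists (MkPinf pg).
by apply: (@braid_averaging_seq R Binf id) => // g _; exists g.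
Qed.
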